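(* Let $N\ge 1$, $T>0$, let the costs $C,\tilde C$ satisfy all the assumptions listed in the context, and let an initial distribution $(\rho_0^0,\dots,\rho^0_{2^N-1})$ of masses on the nodes be given. Let $\varepsilon=T/m$ with $m\in\mathbb N$, $m\ge1$, and let $\mathcal C_\varepsilon$ and the multi-valued map $\psi_\varepsilon$ on $\mathcal C_\varepsilon$ be as defined in the context. Then there exists an $\varepsilon$-mean-field equilibrium, i.e. there exists $\rho_\varepsilon\in \mathcal C_\varepsilon$ such that $\rho_\varepsilon\in\psi_\varepsilon(\rho_\varepsilon)$.
   Context: **Network and controls.** $\mathcal I=\{0,1\}^N$ is the set of nodes, enumerated $p_0,\dots,p_{2^N-1}$; $\bar p=(1,\dots,1)$. For $p\in\mathcal I$, $\mathcal I_p$ is the set of nodes obtained from $p$ by changing exactly one component from $0$ to $1$ (so $\mathcal I_{\bar p}=\emptyset$). An admissible control for $(p,t)\in\mathcal I\times[0,T]$ is a triple $(r,\sigma,\pi)$ with $r$ an integer, $0\le r\le N-\sum_i p^i$, $\sigma=(t_0=t<t_1<\dots<t_r\le T)$, $\pi=(p_{(0)}=p,p_{(1)},\dots,p_{(r)})$, $p_{(i+1)}\in\mathcal I_{p_{(i)}}$, such that: if $1\le r<N-\sum_i p^i$ then $t_r=T$; if $r=0$ then $p=\bar p$ or $t=T$. **Costs.** Let $\mathcal L=L^2([0,T],[0,1])^{2^N}$; an element $\rho=(\rho_0,\dots,\rho_{2^N-1})$ represents the masses on the nodes. The switching cost $C(p,p',t,\tau,\rho)\in[0,+\infty[$ is defined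 for $p'\in\mathcal I_p$, $0\le t<\tau\le T$, $\rho\in\mathcal L$. The final cost $\tilde C:\mathcal I\times[0,T]\to\mathbb R$ is bounded and Lipschitz continuous in time. Set $$J(p,t,(r,\sigma,\pi),\rho)=\sum_{i=1}^rC(p_{(i-1)},p_{(i)},t_{i-1},t_i,\rho)+\tilde C(p_{(r)},t_r)$$ if $p\ne\bar p$ and $t<T$, and $J=\tilde C(p,t)$ if $p=\bar p$ or $t=T$. The value function is $V(p,t,\rho)=\inf_{(r,\sigma,\pi)}J(p,t,(r,\sigma,\pi),\rho)$. **Assumptions.** (i) For all sufficiently small $h>0$, for all $p$, $p'\in\mathcal I_p$, $\tau\in]0,T]$, the map $(t,\rho)\mapsto C(p,p',t,\tau,\rho)$ is bounded and Lipschitz on $[0,\tau-h]\times\mathcal L$ (with the $L^2$ norm), with bound and Lipschitz constant depending only on $h$, not on $\tau$. (ii) For fixed $p,p',t,\rho$, $C$ is decreasing in $\tau\in]t,T]$, and $\lim_{\tau\to t^+}C(p,p',t,\tau,\rho)=+\infty$ uniformly in $(p,p',t,\rho)$; moreover $\tau\mapsto C(p,p',t,\tau,\rho)$ is continuous on $]t,T[$. (iii) By convention, $C$ is $0$ when the two nodes coincide and when $t=\tau=T$. (iv) An agent which at time $t$ on node $p$ decides to switch to $p'$ at time $\tau$ stays on $p$, and counts in the mass of $p$, during $[t,\tau[$; it takes its next decision exactly at time $\tau$. (v) For $p'\in\mathcal I_p$ and $t<T$, say that the switch from $p$ to $p'$ with decision instant $t$ optimally generates $\tau\in]t,T]$ if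 there is an admissible control with $r\ge1$, $t_0=t$, $t_1=\tau$, $p_{(0)}=p$, $p_{(1)}=p'$ minimizing $J$ among all admissible controls with $r\ge1$, $t_0=t$, $p_{(0)}=p$, $p_{(1)}=p'$. It is assumed that, for the same switch from $p$ to $p'$ (and the same $\rho$), if decision instants $t_1<t_2$ optimally generate $\tau_1,\tau_2<T$ respectively, then $\tau_1<\tau_2$. **Optimal switches.** For $p\ne\bar p$, $t<T$, $P_\rho(p,t)$ is the set of pairs $(p',t')$, $p'\in\mathcal I_p$, $t'\in]t,T]$, minimizing $V(p',t',\rho)+C(p,p',t,t',\rho)$. **Initial masses.** $\rho_j^0\ge0$ is the mass of agents on node $p_j$ at time $0$, with $\sum_j\rho_j^0\le1$. **The space $\mathcal C_\varepsilon$.** An element of $\mathcal L$ is identified, by juxtaposing its $2^N$ components, with an element of $L^2([0,2^NT],[0,1])$. $\mathcal C_\varepsilon$ is the set of those that are constant on each open interval of the partition $0<\varepsilon<2\varepsilon<\dots<2^NT$ and whose sup norm is at most $\sum_j\rho^0_j$. It carries the $L^2$ topology. **The map $\psi_\varepsilon$.** For $\tau\in[0,T]$, let $F(\tau)$ be the set of points of $\{0,\varepsilon,2\varepsilon,\dots,T\}$ nearest to $\tau$ (one point, or two if $\tau$ is the midpoint of two consecutive ones). Let $\rho\in\mathcal C_\varepsilon$. An optimal path from $p_j$ is a sequence $(q_0,s_0)=(p_j,0),(q_1,s_1),\dots,(q_r,s_r)$ with $(q_{i+1},s_{i+1})\in P_\rho(q_i,s_i)$ for $0\le i<r$, stopping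 when $q_r=\bar p$ or $s_r=T$. An $\varepsilon$-optimal path from $p_j$ is a sequence $\pi=((q_0,\tilde s_0),\dots,(q_r,\tilde s_r))$ with $\tilde s_0=0$ and $\tilde s_i\in F(s_i)$ for $i\ge1$, for some optimal path $(q_0,s_0)=(p_j,0),(q_1,s_1),\dots,(q_r,s_r)$ from $p_j$; there are finitely many of them, and $\Pi_j$ denotes their set. The evolution of a unit mass following $\pi$ is $E^\pi=(E^\pi_0,\dots,E^\pi_{2^N-1})$, where $E^\pi_k(t)=1$ if $p_k=q_i$ for some $i$ with $\tilde s_i\le t<\tilde s_{i+1}$ (with $\tilde s_{r+1}:=T$), and $E^\pi_k(t)=0$ otherwise (for a.e. $t$). Then $\psi_\varepsilon(\rho)$ is the set of all $$\tilde\rho=\sum_{j=0}^{2^N-1}\rho_j^0\sum_{\pi\in\Pi_j}w_\pi E^\pi,\qquad w_\pi\ge0,\quad \sum_{\pi\in\Pi_j}w_\pi=1\ \text{ for every } j.$$ The weight $w_\pi$ is the product, along $\pi$, of the fractions according to which agents split at each decision among the $\varepsilon$-optimal next (node, time) pairs. *)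

(* Defs.v *)
From HB Require Import structures.
From mathcomp Require Import all_boot all_order all_algebra.
From mathcomp Require Import all_classical all_reals all_analysis.

Set Implicit Arguments.
Unset Strict Implicit.
Unset Printing Implicit Defensive.

Import Order.TTheory GRing.Theory Num.Theory.
Import numFieldNormedType.Exports.

Local Open Scope classical_set_scope.
Local Open Scope ring_scope.

Definition node (N : nat) : finType := {ffun 'I_N -> bool}.

Definition top_node (N : nat) : node N := [ffun=> true].

(* [next_node p p'] means that p' is in I_p. *)
Definition next_node (N : nat) (p p' : node N) : bool :=
  [exists i, ~~ p i && (p' == [ffun k => (k == i) || p k])].

(* Lebesgue measure restricted to [0, a], so that L^2 of this measure on the
   whole line is L^2([0, a]). *)
Definition leb0 (R : realType) (a : R) :
    {measure set (measurableTypeR R) -> \bar R} :=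
  mrestr lebesgue_measure (measurable_itv `[0, a]).

Definition L2 (R : realType) (T : R) := LspaceType (leb0 T) (lee1n 2).

Section Masses.
Context (R : realType) (N : nat) (T : R).

(* The product over the nodes of L^2([0, T], [0, 1]). *)
Definition masses : set (node N -> L2 T) :=
  [set rho | forall p, \forall x \ae leb0 T, 0 <= (rho p x : R) <= 1].

Definition L2dist (rho rho' : node N -> L2 T) : R :=
  Num.sqrt (\sum_p
    (fine ('N[leb0 T]_2%:E [(fun x => (rho p x - rho' p x : R)%:E)])%E) ^+ 2).

(* The j-th component occupies [j T, (j+1) T); nodes are enumerated by [enum]. *)
Definition juxtapose (rho : node N -> L2 T) (x : R) : R :=
  let j := Num.truncn (x / T) in
  rho (nth (top_node N) (enum (node N)) j) (x - j%:R * T).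

Definition C_eps (m : nat) (rho0 : node N -> R) : set (node N -> L2 T) :=
  let eps := T / m%:R in
  let Tend := (2 ^ N)%N%:R * T in
  [set rho | [/\ masses rho,
    forall k : nat, (k < 2 ^ N * m)%N ->
      exists c : R, \forall x \ae leb0 Tend,
        k%:R * eps < x < k.+1%:R * eps -> juxtapose rho x = c
    & ('N[leb0 Tend]_+oo [EFin \o juxtapose rho] <= (\sum_p rho0 p)%:E)%E]].

End Masses.

Section Game.
Context (R : realType) (N : nat) (T : R).

(* [C p p' t tau rho]; values are only relevant for [next_node p p'],
   0 <= t < tau <= T and [masses rho]. *)
Variable C : node N -> node N -> R -> R -> (node N -> L2 T) -> R.
Variable Cf : node N -> R -> R.

(* A control (r, sigma, pi) for (p, t) is encoded by the list of the pairs
   (p_(i), t_i), 1 <= i <= r; the pair of index 0 is (p, t). *)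
Definition control := seq (node N * R).

Definition admissible (p : node N) (t : R) (c : control) : Prop :=
  let r := size c in
  let rmax := (N - \sum_(i < N) p i)%N in
  [/\ (r <= rmax)%N,
      path (fun a b => next_node a.1 b.1 && (a.2 < b.2)) (p, t) c,
      all (fun a => a.2 <= T) c,
      (1 <= r < rmax)%N -> (last (p, t) c).2 = T
    & r = 0%N -> p = top_node N \/ t = T].

Definition J (p : node N) (t : R) (c : control) (rho : node N -> L2 T) : R :=
  let z i := nth (p, t) ((p, t) :: c) i in
  if (p != top_node N) && (t < T) then
    \sum_(i < size c) C (z i).1 (z i.+1).1 (z i).2 (z i.+1).2 rho
      + Cf (z (size c)).1 (z (size c)).2
  else Cf p t.

Definition V (p : node N) (t : R) (rho : node N -> L2 T) : R :=
  inf [set J p t c rho | c in admissible p t].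

Definition cost_nonneg : Prop :=
  forall p p' t tau rho, next_node p p' -> 0 <= t -> t < tau -> tau <= T ->
    masses rho -> 0 <= C p p' t tau rho.

Definition cost_regular : Prop :=
  exists2 h0 : R, 0 < h0 & forall h, 0 < h < h0 ->
    exists B K : R, forall p p' tau, next_node p p' -> 0 < tau <= T ->
      (forall t rho, 0 <= t <= tau - h -> masses rho ->
         `|C p p' t tau rho| <= B) /\
      (forall t t' rho rho', 0 <= t <= tau - h -> 0 <= t' <= tau - h ->
         masses rho -> masses rho' ->
         `|C p p' t tau rho - C p p' t' tau rho'|
           <= K * (`|t - t'| + L2dist rho rho')).

Definition cost_decreasing : Prop :=
  forall p p' t rho, next_node p p' -> 0 <= t < T -> masses rho ->
    forall tau tau', t < tau -> tau <= tau' -> tau' <= T ->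
      C p p' t tau' rho <= C p p' t tau rho.

Definition cost_blowup : Prop :=
  forall M : R, exists2 delta : R, 0 < delta &
    forall p p' t rho tau, next_node p p' -> 0 <= t < T -> masses rho ->
      t < tau -> tau <= T -> tau < t + delta -> M < C p p' t tau rho.

Definition cost_continuous : Prop :=
  forall p p' t rho, next_node p p' -> 0 <= t < T -> masses rho ->
    {in `]t, T[, continuous (fun tau : R => C p p' t tau rho)}.

Definition cost_convention : Prop :=
  (forall p t tau rho, 0 <= t -> t <= tau -> tau <= T -> masses rho ->
     C p p t tau rho = 0) /\
  (forall p p' rho, masses rho -> C p p' T T rho = 0).

Definition final_cost_regular : Prop :=
  forall p, [bounded Cf p t | t in `[0, T]%classic] /\
            [lipschitz Cf p t | t in `[0, T]%classic].

(* The controls with r >= 1, p_(0) = p, t_0 = t and p_(1) = p' are those of the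
   form (p', s) :: c. *)
Definition optimally_generates (rho : node N -> L2 T) (p p' : node N)
    (t tau : R) : Prop :=
  exists2 c, admissible p t ((p', tau) :: c) &
    forall s c', admissible p t ((p', s) :: c') ->
      J p t ((p', tau) :: c) rho <= J p t ((p', s) :: c') rho.

Definition order_preserving : Prop :=
  forall rho p p' t1 t2 tau1 tau2, masses rho -> next_node p p' ->
    0 <= t1 -> t1 < t2 -> t2 < T -> tau1 < T -> tau2 < T ->
    optimally_generates rho p p' t1 tau1 ->
    optimally_generates rho p p' t2 tau2 ->
    tau1 < tau2.

Definition opt_switch (rho : node N -> L2 T) (p : node N) (t : R) :
    set (node N * R) :=
  let feasible (z : node N * R) :=
    [/\ p != top_node N, t < T, next_node p z.1 & t < z.2 <= T] in
  let cost (z : node N * R) := V z.1 z.2 rho + C p z.1 t z.2 rho in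
  [set z | feasible z /\ forall z', feasible z' -> cost z <= cost z'].

(* [(p, 0) :: c] is an optimal path from p.  Paths cannot be continued past a
   stopping point, as [opt_switch] is empty there. *)
Definition optimal_path (rho : node N -> L2 T) (p : node N)
    (c : seq (node N * R)) : Prop :=
  path (fun a b => b \in opt_switch rho a.1 a.2) (p, 0) c /\
  let z := last (p, 0) c in z.1 = top_node N \/ z.2 = T.

Definition grid (m : nat) : set R :=
  [set k%:R * (T / m%:R) | k in [set k : nat | (k <= m)%N]].

Definition nearest (m : nat) (tau : R) : set R :=
  [set x | grid m x /\ forall y, grid m y -> `|x - tau| <= `|y - tau|].

Definition eps_paths (m : nat) (rho : node N -> L2 T) (p : node N) :
    set (seq (node N * R)) :=
  [set pi | exists c ce, [/\ pi = (p, 0) :: ce, optimal_path rho p c,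
     unzip1 ce = unzip1 c
   & all2 (fun se s => se \in nearest m s) (unzip2 ce) (unzip2 c)]].

(* The default value T of [nth] implements the convention s_(r+1) := T. *)
Definition evolution (pi : seq (node N * R)) (k : node N) (t : R) : R :=
  \1_[set t : R | exists2 i, (i < size pi)%N &
        nth k (unzip1 pi) i = k /\
        nth T (unzip2 pi) i <= t < nth T (unzip2 pi) i.+1] t.

(* [eps_paths m rho j] is finite: nodes strictly increase along a path and times
   lie on the grid.  So [\sum_(pi \in _)] is the genuine sum over that set. *)
Definition psi (m : nat) (rho0 : node N -> R) (rho : node N -> L2 T) :
    set (node N -> L2 T) :=
  [set rhot | exists w : node N -> seq (node N * R) -> R,
    [/\ forall j pi, eps_paths m rho j pi -> 0 <= w j pi,
        forall j, \sum_(pi \in eps_paths m rho j) w j pi = 1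
      & forall k, \forall t \ae leb0 T,
          rhot k t = \sum_j (rho0 j *
            \sum_(pi \in eps_paths m rho j) (w j pi * evolution pi k t))]].

End Game.

(* Main.v *)
From HB Require Import structures.
Require Import Defs.
From mathcomp Require Import all_boot all_order all_algebra.
From mathcomp Require Import zify ring lra.

(* A mixed profile w (a probability on the finitely many ways of assigning a grid
   path to every starting node) generates masses G(w) depending continuously on
   w. The sets A_s of those w for which the pure profile s is eps-optimal against
   G(w) cover the simplex, since optimal paths exist, and they are closed: the
   value function is lower semicontinuous in (time, masses) and upper
   semicontinuous in the masses, and the blow-up of the switching cost keeps
   successive switching times apart, so limits of optimal paths are optimal.
   A fixed point is a w such that w in A_s whenever w_s > 0. It is obtained from
   Scarf's combinatorial lemma: colour each point of a fine grid of the simplex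
   by some s with w in A_s; a dominant set carrying all the colours of its face
   has small diameter, and its limit is the required w. Limits are taken along an
   ultrafilter on nat, so that no subsequence has to be extracted. *)

Set Implicit Arguments.
Unset Strict Implicit.
Unset Printing Implicit Defensive.

(** * Scarf's lemma *)

Section Scarf.
Variables (X I : finType) (v : I -> X -> nat).
Hypothesis v_inj : forall i, injective (v i).

(** The condition on [w] is a complementarity condition, and it already is the fixed-point property:
    when every profile of positive weight is [eps]-optimal against [G w], pushing [w] forward to the
    paths of each starting node gives weights carried by its [eps]-optimal paths, and the mixture of
    these paths is [G w] itself. Scarf's lemma puts no boundary condition on the colours, so any
    optimal profile may be chosen at each grid point. The obstacle is that [V] is not continuous in
    time at [T]. Minimality still passes to the limit because the two sides of the comparison behave
    differently: the arrival time of the limiting switch moves, which calls for lower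
    semicontinuity, while a competitor keeps its arrival time, so that upper semicontinuity in the
    masses is enough for it. *)

Definition dominant (S : {set X}) : bool :=
  [forall y, exists i, forall x in S, v i y <= v i x].

Lemma dominantP (S : {set X}) :
  reflect (forall y, exists i, forall x, x \in S -> v i y <= v i x) (dominant S).
Proof.
apply: (iffP forallP) => [h y|h y].
  by have /existsP[i /forall_inP hi] := h y; exists i.
by have [i hi] := h y; apply/existsP; exists i; apply/forall_inP.
Qed.

Lemma dominantS (S S' : {set X}) : S \subset S' -> dominant S' -> dominant S.
Proof.
move=> /subsetP sSS' /dominantP h; apply/dominantP => y.
by have [i hi] := h y; exists i => x /sSS'; apply: hi.
Qed.

Section Door.
Variable tau : {set X}.
Hypotheses (tau_dom : dominant tau) (card_tau : #|tau|.+1 = #|I|).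
Variable t0 : X.
Hypothesis t0_tau : t0 \in tau.

Definition lowest (i : I) : X := [arg min_(x < t0 in tau) v i x].

Lemma lowest_in i : lowest i \in tau.
Proof. by rewrite /lowest; case: arg_minnP. Qed.

Lemma lowest_min i x : x \in tau -> v i (lowest i) <= v i x.
Proof. by rewrite /lowest; case: arg_minnP => // z _ h /h. Qed.

Lemma lowest_uniq i x :
  x \in tau -> (forall z, z \in tau -> v i x <= v i z) -> x = lowest i.
Proof.
move=> xt h; apply: (@v_inj i); apply/eqP.
by rewrite eqn_leq lowest_min // h ?lowest_in.
Qed.

Lemma lowest_surj x : x \in tau -> exists i, lowest i = x.
Proof.
by move=> xt; have /dominantP/(_ x)[i hi] := tau_dom; exists i; rewrite -(lowest_uniq xt).
Qed.

Lemma lowest_collision : exists a b, [/\ a != b & lowest a = lowest b].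
Proof.
have /injectivePn[a [b ab lab]] : ~~ injectiveb lowest.
  apply/injectiveP => linj.
  have : #|lowest @: setT| <= #|tau|.
    by apply/subset_leq_card/subsetP => _ /imsetP[i _ ->]; apply: lowest_in.
  by rewrite card_imset // cardsT -card_tau ltnn.
by exists a, b.
Qed.

(* The candidates for the vertex added to [tau] when its [k]-th lowest element
   is replaced by a new one. *)
Definition above (k : I) : {set X} :=
  [set x | [forall i, (i != k) ==> (v i (lowest i) < v i x)]].

Lemma aboveP k x :
  reflect (forall i, i != k -> v i (lowest i) < v i x) (x \in above k).
Proof.
rewrite inE; apply: (iffP forallP) => h i; first by move=> ik; have := h i; rewrite ik.
by apply/implyP/h.
Qed.

Variables a b : I.
Hypotheses (ab : a != b) (lab : lowest a = lowest b).

Lemma lowest_surj_off k x :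
  k \in [set a; b] -> x \in tau -> exists2 i, i != k & lowest i = x.
Proof.
move=> kab /lowest_surj[i ix]; case: (eqVneq i k) => [ik|]; last by exists i.
subst k; move: kab; rewrite !inE => /orP[]/eqP ?; subst i.
  by exists b; [rewrite eq_sym|rewrite -lab].
by exists a => //; rewrite lab.
Qed.

(** Without [k] there remain as many indices as elements of [tau], and [lowest] is still onto, so it
    is injective there. Hence [a] and [b] are the only indices that collide. *)
Lemma lowest_inj_off k i j :
  k \in [set a; b] -> i != k -> j != k -> lowest i = lowest j -> i = j.
Proof.
move=> kab ik jk; pose D := [set~ k].
suff /imset_injP : #|lowest @: D| == #|D|.
  by move=> h /h; apply; rewrite !inE.
have -> : lowest @: D = tau.
  apply/setP => x; apply/imsetP/idP => [[l _ ->]|]; first exact: lowest_in.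
  by move=> /(lowest_surj_off kab)[l lk <-]; exists l; rewrite ?inE.
by rewrite cardsC1 -card_tau.
Qed.

Lemma lowest_collisionE i j :
  lowest i = lowest j -> i != j -> i \in [set a; b].
Proof.
move=> lij; apply: contraNT; rewrite !inE negb_or => /andP[ia ib].
case: (eqVneq j a) => [ja|ja]; last first.
  by apply/eqP/(lowest_inj_off _ ia ja lij); rewrite !inE eqxx.
have jb : j != b by rewrite ja.
by apply/eqP/(lowest_inj_off _ ib jb lij); rewrite !inE eqxx orbT.
Qed.

(** In the labyrinth picture [tau] is a door, and the sets [x |: tau] for these [x] are the rooms it
    opens into. *)
Definition rooms : {set X} := [set x | (x \notin tau) && dominant (x |: tau)].

(** In a dominant [x |: tau] every element is lowest in some order, so [x] takes over one of the two
    colliding orders, [k], and lies above the lowest elements in all the others. A point of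
    [above k] higher than [x] in order [k] would be dominated in no order. *)
Lemma roomsE x :
  reflect (exists2 k, k \in [set a; b] &
            x \in above k /\ forall y, y \in above k -> v k y <= v k x)
          (x \in rooms).
Proof.
rewrite inE; apply: (iffP andP) => [[xt /dominantP xdom]|[k kab [/aboveP xk xmax]]].
  have [k hk] := xdom x.
  have ktau z : z \in tau -> exists2 j, j != k & lowest j = z /\ v j z < v j x.
    move=> zt; have [j hj] := xdom z.
    have zx : z != x by apply: contraNneq xt => <-.
    have zxj : v j z < v j x.
      by rewrite ltn_neqAle hj ?setU11 // andbT; apply: contraNneq zx => /v_inj ->.
    exists j; last first.
      by split=> //; rewrite -(lowest_uniq zt) // => y yt; apply: hj; rewrite setU1r.
    apply: contraTneq zxj => ->; rewrite -leqNgt; apply: hk; exact: setU1r.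
  have kab : k \in [set a; b].
    have [j jk [lj _]] := ktau _ (lowest_in k).
    by apply: (@lowest_collisionE k j); rewrite // eq_sym.
  have xk : x \in above k.
    apply/aboveP => i ik; have [j jk [lj]] := ktau _ (lowest_in i).
    case: (eqVneq i j) => [->//|ij _].
    have iab := lowest_collisionE (esym lj) ij.
    have jab : j \in [set a; b] by apply: (lowest_collisionE lj); rewrite eq_sym.
    move: kab iab jab jk ik ij; rewrite !inE.
    by do 3![case/orP=> /eqP->]; rewrite ?eqxx.
  exists k => //; split=> // y /aboveP yk; have [i hi] := xdom y.
  case: (eqVneq i k) => [<-|ik]; first by apply: hi; rewrite setU11.
  by have := yk i ik; rewrite ltnNge hi // setU1r // lowest_in.
split.
  apply/negP => /(lowest_surj_off kab)[i ik lx].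
  by have := xk i ik; rewrite lx ltnn.
apply/dominantP => y; case: (boolP (y \in above k)) => [yk|].
  have [i hi] := dominantP _ tau_dom y.
  have ik : i = k.
    apply/eqP; apply: contraT => ik.
    by move/aboveP: yk => /(_ i ik); rewrite ltnNge hi // lowest_in.
  by exists k => z /setU1P[->|/hi]; [exact: xmax|rewrite ik].
rewrite inE negb_forall => /existsP[i]; rewrite negb_imply -leqNgt => /andP[ik yi].
exists i => z /setU1P[->|zt]; first by apply: leq_trans yi _; apply/ltnW/xk.
by apply: leq_trans yi _; apply: lowest_min.
Qed.

Lemma above_disj x : x \in above a -> x \in above b -> False.
Proof.
move=> /aboveP xa /aboveP xb; have [i hi] := dominantP _ tau_dom x.
suff : v i (lowest i) < v i x by rewrite ltnNge hi // lowest_in.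
by case: (eqVneq i a) => [->|/xa//]; apply: xb.
Qed.

(** The orders are injective, so a nonempty [above k] has a single top element. A common element of
    [above a] and [above b] would exceed the lowest element of [tau] in every order, against its
    dominance. *)
Lemma card_rooms : #|rooms| = (above a != set0) + (above b != set0).
Proof.
have top k : above k != set0 ->
    exists2 x, x \in above k & forall y, y \in above k -> v k y <= v k x.
  case/set0Pn=> x0 x0k; case: (@arg_maxnP _ x0 (mem (above k)) (v k)) => // x xk xmax.
  by exists x.
have uniq_top k x y : x \in above k -> y \in above k ->
    (forall z, z \in above k -> v k z <= v k x) ->
    (forall z, z \in above k -> v k z <= v k y) -> x = y.
  by move=> xk yk hx hy; apply: (@v_inj k); apply/eqP; rewrite eqn_leq hx ?hy.
case: (eqVneq (above a) set0) => [a0|/top[x xa hx]];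
  case: (eqVneq (above b) set0) => [b0|/top[y yb hy]] /=.
- apply/eqP; rewrite cards_eq0; apply/eqP/setP => z; rewrite in_set0.
  apply/negbTE/negP => /roomsE[k]; rewrite in_set2.
  by case/orP=> /eqP-> []; rewrite ?a0 ?b0 in_set0.
- rewrite add0n -(cards1 y); apply: eq_card => z; rewrite in_set1; apply/roomsE/eqP.
    case=> k; rewrite in_set2 => /orP[]/eqP-> []; first by rewrite a0 in_set0.
    by move=> zb hz; apply: (uniq_top b).
  by move=> ->; exists b; rewrite ?in_set2 ?eqxx ?orbT.
- rewrite addn0 -(cards1 x); apply: eq_card => z; rewrite in_set1; apply/roomsE/eqP.
    case=> k; rewrite in_set2 => /orP[]/eqP-> []; last by rewrite b0 in_set0.
    by move=> za hz; apply: (uniq_top a).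
  by move=> ->; exists a; rewrite ?in_set2 ?eqxx.
have xy : x != y by apply/eqP => xy; apply: (@above_disj x) => //; rewrite xy.
have <- : #|[set x; y]| = 1 + 1 by rewrite cards2 xy.
apply: eq_card => z; rewrite in_set2; apply/roomsE/orP.
  case=> k; rewrite in_set2 => /orP[]/eqP-> [zk hz]; [left|right]; apply/eqP.
    exact: (uniq_top a).
  exact: (uniq_top b).
by case=> /eqP->; [exists a|exists b]; rewrite ?in_set2 ?eqxx ?orbT.
Qed.

End Door.

(** The [e i] are artificial boundary points, one per colour, the analogue of slack vectors; [x0] is
    some ordinary point. *)
Variables (c : X -> I) (e : I -> X) (x0 : X).
Hypothesis ceK : forall i, c (e i) = i.
Hypothesis e_min : forall i x, v i (e i) <= v i x.
Hypothesis e_big : forall i j x, i != j -> x \notin codom e -> v i x < v i (e j).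
Hypothesis x0_notin : x0 \notin codom e.

Section Colour.
Variable i0 : I.

Let good (tau : {set X}) := (#|tau|.+1 == #|I|) && (c @: tau == [set~ i0]).
Let E : {set X} := e @: [set~ i0].

Let e_inj : injective e. Proof. by move=> i j h; rewrite -(ceK i) h ceK. Qed.

Let goodE : good E.
Proof.
rewrite /good card_imset // cardsC1 prednK; last by apply/card_gt0P; exists i0.
rewrite eqxx; apply/eqP/setP => i; apply/imsetP/idP.
  by case=> _ /imsetP[j j0 ->] ->; rewrite ceK.
by move=> ii0; exists (e i); rewrite ?ceK // imset_f.
Qed.

Let domE : dominant E.
Proof.
apply/dominantP => y; case: (boolP (y \in codom e)) => [/codomP[l ->]|yE].
  by exists l => x _; apply: e_min.
exists i0 => _ /imsetP[j j0 ->]; apply/ltnW/e_big => //.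
by move: j0; rewrite !inE eq_sym.
Qed.

Let good_sub_codom tau : good tau -> {subset tau <= codom e} -> tau = E.
Proof.
case/andP=> _ /eqP/setP ctau sub; apply/setP => x; apply/idP/imsetP.
  move=> xt; have /codomP[i xi] := sub _ xt; exists i => //.
  by rewrite -ctau -(ceK i) -xi; apply: imset_f.
case=> i; rewrite -ctau => /imsetP[y yt iy] ->.
by have /codomP[j yj] := sub _ yt; rewrite iy yj ceK -yj.
Qed.

(** If [S] misses a colour and has a good door, exactly two of its points share a colour, and its
    good doors are the two sets obtained by dropping one of them. *)
Lemma even_doors (S : {set X}) : c @: S != setT ->
  ~~ odd #|[set tx : {set X} * X | [&& good tx.1, tx.2 \notin tx.1,
                                    dominant (tx.2 |: tx.1) & tx.2 |: tx.1 == S]]|.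
Proof.
move=> ncS; set F := [set tx | _]; case: (eqVneq F set0) => [->|]; first by rewrite cards0.
case/set0Pn=> -[tau x]; rewrite inE /= => /and4P[gt xt dS /eqP xS].
have injg t : good t -> {in t &, injective c}.
  case/andP=> /eqP ct /eqP cct; apply/imset_injP; rewrite cct cardsC1 -ct.
  by rewrite /=.
have /andP[/eqP ct /eqP cct] := gt.
have cx : c x != i0.
  apply: contra ncS => /eqP cx; rewrite -xS imsetU1 cct cx.
  by apply/eqP/setP => i; rewrite !inE orbN.
have [x' x't cx'] : exists2 x', x' \in tau & c x = c x'.
  by apply/imsetP; rewrite cct !inE.
have xx' : x != x' by apply: contraNneq xt => ->.
have S' : x' |: (S :\ x') = S by rewrite setD1K // -xS setU1r.
suff -> : F = [set (tau, x); (S :\ x', x')].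
  by rewrite cards2; case: eqP => // -[_ /eqP]; rewrite (negbTE xx').
apply/setP => -[t y]; rewrite !inE /= !xpair_eqE; apply/and4P/orP; last first.
  case=> /andP[/eqP -> /eqP->]; first by rewrite xS -xS dS eqxx gt xt.
  rewrite S' -xS dS eqxx setD11; split => //; apply/andP; split.
    by have := cardsD1 x' (x |: tau); rewrite setU1r // cardsU1 xt -ct /=; lia.
  rewrite -cct; apply/eqP/setP => i; apply/imsetP/imsetP.
    case=> z; rewrite !inE => /andP[zx' /orP[/eqP->|zt]] ->; first by exists x'.
    by exists z.
  case=> z zt ->; case: (eqVneq z x') => [->|zx'].
    by exists x; rewrite // !inE eqxx xx'.
  by exists z; rewrite // !inE zx' zt orbT.
case=> gt' yt _ /eqP yS.
have [yx|yx] := eqVneq y x.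
  by left; rewrite -(setU1K yt) yS yx -xS setU1K ?eqxx.
right; have ytau : y \in tau.
  by have : y \in S by [rewrite -yS setU11]; rewrite -xS => /setU1P[/eqP|//]; rewrite (negbTE yx).
have [z zt cyz] : exists2 z, z \in t & c y = c z.
  apply/imsetP; have /andP[_ /eqP ->] := gt'; rewrite -cct; exact: imset_f.
have zx : z = x.
  have : z \in S by rewrite -yS setU1r.
  rewrite -xS => /setU1P[//|ztau].
  by move: yt; rewrite (injg _ gt _ _ ytau ztau cyz) zt.
have yx' : y = x' by apply: (injg _ gt) => //; rewrite cyz zx.
by rewrite -yx' -yS setU1K ?eqxx.
Qed.

Hypothesis I_gt1 : 1 < #|I|.

(** A good door opens into two rooms, or into none if it is not dominant, except for [E], the
    entrance of the labyrinth, which opens into a single one. *)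
Lemma odd_rooms tau : good tau -> odd #|rooms tau| = (tau == E).
Proof.
move=> gtau; have /andP[/eqP card_tau /eqP c_tau] := gtau.
have [dtau|ndtau] := boolP (dominant tau); last first.
  have -> : rooms tau = set0.
    apply/setP => x; rewrite inE in_set0; apply/negbTE; rewrite negb_and.
    by apply/orP; right; apply: contra ndtau; apply: dominantS; apply: subsetUr.
  rewrite cards0; apply/esym/negbTE; apply: contraNneq ndtau => ->; exact: domE.
have [t0 t0t] : exists t0, t0 \in tau.
  by apply/card_gt0P; rewrite -ltnS card_tau.
have [a [b [ab lab]]] := lowest_collision card_tau t0t.
rewrite (card_rooms dtau card_tau t0t ab lab).
have [tauE|tauNE] := eqVneq tau E; last first.
  (* In every order other than [k] the ordinary point [t] of [tau] lies below [e k], so both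
     [above a] and [above b] contain an artificial point. *)
  have [t tt tNe] : exists2 t, t \in tau & t \notin codom e.
    apply/exists_inP; apply: contraT => /exists_inPn h.
    by case/eqP: tauNE; apply: good_sub_codom => // x /h; rewrite negbK.
  have nz k : above tau t0 k != set0.
    apply/set0Pn; exists (e k); apply/aboveP => i ik.
    by apply: (leq_ltn_trans (lowest_min t0t i tt)); apply: e_big.
  by rewrite !nz.
have eE i : i != i0 -> lowest tau t0 i = e i.
  move=> ii0; apply/esym/lowest_uniq => //.
  by rewrite tauE imset_f ?inE.
have nz : above tau t0 i0 != set0.
  apply/set0Pn; exists x0; apply/aboveP => i ii0; rewrite eE //.
  rewrite ltn_neqAle e_min andbT; apply: contra x0_notin.
  by move/eqP/v_inj=> <-; apply: codom_f.
(* A point of [above k] would lie above [e k] in order [i0], hence be some [e l]; but for [l != k]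
   the point [e l] is lowest in order [l], and [e k] does not exceed itself. *)
have z k : k != i0 -> lowest tau t0 k = lowest tau t0 i0 -> above tau t0 k = set0.
  move=> ki0 lk; apply/setP => x; rewrite in_set0; apply/negbTE/negP => /aboveP xk.
  have xi0 := xk i0; rewrite eq_sym ki0 in xi0; have {xi0} xi0 := xi0 isT.
  have /codomP[l xl] : x \in codom e.
    apply: contraLR xi0 => xe; rewrite -leqNgt -lk eE //.
    by apply/ltnW/e_big => //; rewrite eq_sym.
  subst x.
  have [?|li0] := eqVneq l i0; first by subst l; move: xi0; rewrite ltnNge e_min.
  have [?|lk'] := eqVneq l k; first by subst l; move: xi0; rewrite -lk eE ?ltnn.
  by have := xk l lk'; rewrite eE ?ltnn.
have [ai0|ai0] := eqVneq a i0.
  have bi0 : b != i0 by rewrite -ai0 eq_sym.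
  by rewrite ai0 nz (z b bi0) ?eqxx // -ai0.
have [bi0|bi0] := eqVneq b i0.
  by rewrite bi0 nz (z a ai0) ?eqxx // -bi0.
by move: lab; rewrite !eE // => /e_inj/eqP; rewrite (negbTE ab).
Qed.

End Colour.

(** Double counting of the pairs of a good door and a room behind it. By doors, only [E] contributes
    an odd number; by rooms, a set that misses a colour contributes an even number. Hence some room
    has all the colours. *)
Lemma scarf : 1 < #|I| -> exists2 S, dominant S & c @: S = setT.
Proof.
move=> I_gt1; have [i0 _] : exists i0 : I, i0 \in I by apply/card_gt0P/ltnW.
pose good (tau : {set X}) := (#|tau|.+1 == #|I|) && (c @: tau == [set~ i0]).
pose E := e @: [set~ i0].
pose P := [set tx : {set X} * X | [&& good tx.1, tx.2 \notin tx.1 & dominant (tx.2 |: tx.1)]].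
have goodE : good E.
  rewrite /good card_imset; last exact: can_inj ceK.
  rewrite cardsC1 prednK ?eqxx /=; last exact: ltnW.
  apply/eqP/setP => i; apply/imsetP/idP => [[_ /imsetP[j j0 ->] ->]|ii0].
    by rewrite ceK.
  by exists (e i); rewrite ?ceK // imset_f.
have oddP : odd #|P|.
  have -> : #|P| = \sum_t \sum_(x | (t, x) \in P) 1.
    by rewrite pair_big_dep -sum1_card; apply: eq_bigl => -[].
  rewrite (big_morph odd oddD erefl) (bigD1 E) //= [X in _ (+) X]big1 ?addbF.
    have : odd #|rooms E| by rewrite (odd_rooms I_gt1 goodE) eqxx.
    rewrite -sum1_card; congr (is_true (odd _)).
    by apply: eq_bigl => x; rewrite !inE /= goodE.
  move=> t tE; case: (boolP (good t)) => gt; last first.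
    by rewrite big1 // => x; rewrite inE /= (negbTE gt).
  rewrite -(negbTE tE) -(odd_rooms I_gt1 gt) -sum1_card; congr odd.
  by apply: eq_bigl => x; rewrite !inE /= gt.
have [/existsP[S /andP[dS /eqP cS]]|/existsPn noS] :=
  boolP [exists S, dominant S && (c @: S == setT)]; first by exists S.
move: oddP; rewrite -sum1_card (partition_big (fun tx => tx.2 |: tx.1) predT) //=.
rewrite (big_morph odd oddD erefl) big1 // => S _; apply/negbTE.
case: (eqVneq (c @: S) setT) => cS; last first.
  have := even_doors i0 cS; rewrite -sum1_card; congr (~~ odd _).
  by apply: eq_bigl => -[t x]; rewrite !inE /= -!andbA.
rewrite big1 // => -[t x]; rewrite inE /= => /andP[/and3P[_ _ dS] /eqP xS].
by have := noS S; rewrite -xS dS xS cS eqxx.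
Qed.
End Scarf.

From mathcomp Require Import all_classical all_reals all_analysis.
From mathcomp Require Import measurable_realfun ess_sup_inf.

Import Order.TTheory GRing.Theory Num.Theory.
Import numFieldNormedType.Exports.

(** * Scarf's lemma on a grid of the simplex *)

Section Grid.
Local Open Scope nat_scope.
Variables (I : finType) (K : nat).

Definition grid_point := {x : {ffun I -> 'I_K.+1} | \sum_i x i == K}.

Definition grid_coord (x : grid_point) (i : I) : nat := val x i.

Lemma grid_sum (x : grid_point) : \sum_i grid_coord x i = K.
Proof. by rewrite /grid_coord; exact/eqP/(valP x). Qed.

Lemma grid_pointP (f : I -> nat) : \sum_i f i = K ->
  exists x : grid_point, forall i, grid_coord x i = f i.
Proof.
move=> sf; pose g : {ffun I -> 'I_K.+1} := [ffun i => inord (f i)].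
have gf i : g i = f i :> nat.
  by rewrite ffunE inordK // ltnS -sf (bigD1 i) //= leq_addr.
have gP : \sum_i g i == K by apply/eqP; apply: etrans sf; apply: eq_bigr => i _; rewrite gf.
by exists (exist _ g gP) => i; rewrite /grid_coord gf.
Qed.

Let X : finType := (grid_point + I)%type.
Let M := #|X|.+1.
(* The lexicographic order on (coordinate, index), with [inr i] placed below
   everything in the [i]-th order and above the grid in the other orders. *)
Let height (i : I) (x : X) : nat :=
  match x with
  | inl t => (grid_coord t i).+1
  | inr j => if j == i then 0 else K.+2
  end.
Let rank (i : I) (x : X) : nat := height i x * M + enum_rank x.

Let rank_inj i : injective (rank i).
Proof.
move=> x y /(congr1 (modn^~ M)); rewrite /rank !modnMDl !modn_small.
- by move/ord_inj/enum_rank_inj.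
- by apply: leqW; apply: ltn_ord.
- by apply: leqW; apply: ltn_ord.
Qed.

Let rank_height i x y : height i x < height i y -> rank i x < rank i y.
Proof.
move=> h; rewrite /rank; have := ltn_ord (enum_rank x); rewrite -/M => hx.
apply: (@leq_trans ((height i x).+1 * M)); last first.
  by apply: leq_trans (leq_addr _ _); rewrite leq_mul2r h orbT.
by rewrite mulSn addnC ltn_add2r; apply: leqW.
Qed.

Let height_rank i x y : rank i x <= rank i y -> height i x <= height i y.
Proof. by apply: contraTT; rewrite -!ltnNge; apply: rank_height. Qed.

Variable col : grid_point -> I.
Hypothesis I_gt1 : 1 < #|I|.

Lemma grid_point_exists : exists x : grid_point, true.
Proof.
have [i0 _] : exists i0 : I, i0 \in I by apply/card_gt0P/ltnW.
have [|x _] := @grid_pointP (fun i => if i == i0 then K else 0); last by exists x.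
by rewrite -big_mkcond big_pred1_eq.
Qed.

(** [C] collects the colours whose artificial point is not in the dominant set, so that a grid point
    must supply them. An order [i] outside [C] dominates no grid point, since [inr i] has height 0
    there. *)
Lemma scarf_grid_dominant : exists (S : {set grid_point}) (C : {set I}),
  (forall i, i \in C -> exists2 x, x \in S & col x = i) /\
  (forall y, exists2 i, i \in C & forall x, x \in S -> grid_coord y i <= grid_coord x i).
Proof.
have [t0 _] := grid_point_exists.
pose c (x : X) := match x with inl t => col t | inr i => i end.
have inlN (t : grid_point) : (inl t : X) \notin codom (inr : I -> X).
  by apply/negP => /codomP[].
have emin i (x : X) : rank i (inr i) <= rank i x.
  case: x => [t|j]; first by apply/ltnW/rank_height; rewrite /= eqxx.
  have [->//|ji] := eqVneq j i; apply/ltnW/rank_height.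
  by rewrite /= eqxx (negbTE ji).
have ebig i j (x : X) : i != j -> x \notin codom (inr : I -> X) -> rank i x < rank i (inr j).
  move=> ij; case: x => [t _|k /negP[]]; last exact: codom_f.
  by apply: rank_height; rewrite /= eq_sym (negbTE ij) ltnS ltnS -ltnS ltn_ord.
have [S /dominantP domS cS] :=
  @scarf X I rank rank_inj c inr (inl t0) (fun i => erefl) emin ebig (inlN t0) I_gt1.
exists [set t | inl t \in S], [set i | inr i \notin S]; split.
  move=> i; rewrite inE => iS; have : i \in c @: S by rewrite cS inE.
  case/imsetP=> -[t|j] zS ic; first by exists t; rewrite ?inE.
  by rewrite ic zS in iS.
move=> y; have [i hi] := domS (inl y); exists i.
  rewrite inE; apply/negP => /hi /height_rank /=; rewrite eqxx //.
by move=> x; rewrite inE => /hi /height_rank /=; rewrite ltnS.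
Qed.

(* A dominant set has small diameter: otherwise the point whose coordinates in
   [C] exceed the minima over the set would not be dominated. *)
Lemma scarf_grid : exists (S : {set grid_point}) (C : {set I}),
  [/\ exists x, x \in S,
      forall i, i \in C -> exists2 x, x \in S & col x = i,
      forall x i, x \in S -> i \notin C -> grid_coord x i < #|I|
    & forall x y i, x \in S -> y \in S -> grid_coord x i < grid_coord y i + #|I|].
Proof.
have [S [C [colS domS]]] := scarf_grid_dominant.
have [t0 _] := grid_point_exists.
have [i1 i1C _] := domS t0.
have [x1 x1S _] := colS _ i1C.
pose low i := grid_coord [arg min_(x < x1 in S) grid_coord x i] i.
have low_min x i : x \in S -> low i <= grid_coord x i.
  by rewrite /low; case: arg_minnP => // z _ h /h.
have low_ex i : exists2 x, x \in S & grid_coord x i = low i.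
  by rewrite /low; case: arg_minnP => // z zS _; exists z.
have big_low : K < \sum_(i in C) (low i).+1.
  rewrite ltnNge; apply/negP => small.
  (* The coordinates must add up to [K]: what remains after [low i + 1] for each [i] in [C] is given
     to [i1]. *)
  pose f i := (i \in C) * ((low i).+1 + (i == i1) * (K - \sum_(i in C) (low i).+1)).
  have [|y yf] := @grid_pointP f.
    transitivity (\sum_(i in C) ((low i).+1 + (i == i1) * (K - \sum_(i in C) (low i).+1))).
      rewrite [RHS]big_mkcond; apply: eq_bigr => i _; rewrite /f.
      by case: (i \in C); rewrite ?mul1n ?mul0n.
    rewrite big_split /=; set L := \sum_(i in C) (low i).+1.
    suff -> : \sum_(i in C) (i == i1) * (K - L) = K - L by rewrite subnKC.
    rewrite (bigD1 i1 i1C) /= eqxx mul1n big1 ?addn0 // => i /andP[_ /negbTE->].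
    by rewrite mul0n.
  have [i iC] := domS y; have [x xS xi] := low_ex i.
  by move/(_ x xS); rewrite yf xi /f iC mul1n -{2}[low i]addn0 addSn -addnS leq_add2l.
(* One unit is lost for each index of [C], whence the bound [#|I|] on the diameter and on the
   coordinates outside [C]. *)
have low_sum : K < \sum_(i in C) low i + #|I|.
  apply: leq_trans big_low _.
  under eq_bigr do rewrite -addn1; rewrite big_split /= sum1_card leq_add2l.
  exact: max_card.
have sumC x : K = \sum_(j in C) grid_coord x j + \sum_(j | j \notin C) grid_coord x j.
  by rewrite -[LHS](grid_sum x) (bigID (mem C)).
have outC x i : x \in S -> i \notin C -> grid_coord x i < #|I|.
  move=> xS iC; rewrite -(ltn_add2l (\sum_(i in C) low i)).
  apply: (leq_ltn_trans _ low_sum); rewrite [leqRHS](sumC x).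
  apply: leq_add; first by apply: leq_sum => j _; apply: low_min.
  by rewrite (bigD1 i) //= leq_addr.
exists S, C; split => //; first by exists x1.
move=> x y i xS yS; case: (boolP (i \in C)) => iC; last first.
  by apply: leq_trans (leq_addl _ _); apply: outC.
have : \sum_(j in C) low j + grid_coord x i <= K + low i.
  rewrite {1}(sumC x) (bigD1 i) //= [X in _ <= X + _ + _](bigD1 i) //=.
  have : \sum_(j in C | j != i) low j <= \sum_(j in C | j != i) grid_coord x j.
    by apply: leq_sum => j _; apply: low_min.
  lia.
by have := low_min y i yS; lia.
Qed.

End Grid.

Local Open Scope classical_set_scope.
Local Open Scope ring_scope.

(** * A covering lemma on the simplex *)

Definition simplex (R : realType) (I : finType) : set (I -> R) :=
  [set w | (forall i, 0 <= w i) /\ \sum_i w i = 1].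

(** * Limits of sequences along an ultrafilter *)

Section Ultralimit.
Variables (R : realType) (U : set_system nat).
Context {UU : UltraFilter U}.

Lemma ultra_cvg_itv (u : nat -> R) (a b : R) :
  (\forall n \near U, a <= u n <= b) -> exists2 l, a <= l <= b & u @ U --> l.
Proof.
move=> uab; have := @segment_compact R a b; rewrite compact_ultra.
have Umap : UltraFilter (u @ U).
  split=> [|G GG UG]; first exact: fmap_proper_filter.
  rewrite eqEsubset; split => // B GB.
  have [//|UnB] := in_ultra_setVsetC (u @^-1` B) UU.
  have /UG GnB : (u @ U) (~` B) by [].
  by have := filter_ex (filterI GB GnB); rewrite setICr => -[].
have Uab : U (u @^-1` `[a, b]) by apply: filterS uab => n; rewrite /= in_itv.
by move=> /(_ _ Umap Uab)[l [/= + ul]]; rewrite in_itv /= => ?; exists l.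
Qed.

Lemma ultra_finite (F : finType) (f : nat -> F) :
  exists a, \forall n \near U, f n = a.
Proof.
apply: contrapT => noa; have : \forall n \near U, forall a, f n != a.
  apply: filter_forall => a.
  have [fa|] := in_ultra_setVsetC [set n | f n = a] UU; first by case: noa; exists a.
  by apply: filterS => n /= /eqP.
by move=> /filter_ex[n /(_ (f n))]; rewrite eqxx.
Qed.

Lemma cvg_near_itv (u : nat -> R) (l a b : R) :
  u @ U --> l -> (\forall n \near U, a <= u n <= b) -> a <= l <= b.
Proof.
move=> ul uab; have [l' l'ab ul'] := ultra_cvg_itv uab.
by rewrite (cvg_unique _ ul ul').
Qed.

Lemma cvg_near_ge (u : nat -> R) (l a : R) :
  u @ U --> l -> (\forall n \near U, a <= u n) -> a <= l.
Proof.
move=> ul ua; have ul1 : \forall n \near U, u n <= l + 1.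
  by move/cvgr_le : ul; apply; rewrite ltrDl.
have uitv : \forall n \near U, a <= u n <= l + 1.
  by apply: filterS2 ua ul1 => n -> ->.
by have /andP[] := cvg_near_itv ul uitv.
Qed.

Lemma ultra_or (P Q : nat -> Prop) :
  (\forall n \near U, P n \/ Q n) -> (\forall n \near U, P n) \/ \forall n \near U, Q n.
Proof.
move=> PQ; have [?|nP] := in_ultra_setVsetC P UU; [by left|right].
by apply: filterS2 PQ nP => n [].
Qed.

Lemma ultra_not (P : nat -> Prop) :
  ~ (\forall n \near U, P n) -> \forall n \near U, ~ P n.
Proof. by have [|//] := in_ultra_setVsetC P UU. Qed.

End Ultralimit.

Section DualKKM.
Variables (R : realType) (U : set_system nat) (I : finType).
Context {UU : UltraFilter U}.
Hypothesis U_oo : \oo `<=` U.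
Variable A : I -> set (I -> R).
Hypothesis A_cover : forall w, simplex w -> exists i, A i w.
Hypothesis A_closed : forall i w (w_ : nat -> I -> R), simplex w ->
  (forall n, simplex (w_ n)) -> (forall j, w_ n j @[n --> U] --> w j) ->
  (\forall n \near U, A i (w_ n)) -> A i w.

Hypothesis I_gt0 : (0 < #|I|)%N.

(** At step [n] the dominant set lies within [#|I| / n.+1] of its point [w n], and a coordinate [i]
    of [w n] above this threshold is in [C], so that some point [z n i] of the set has colour [i].
    In the limit the threshold is 0 and all these points merge. *)
Lemma dual_KKM : exists2 w, simplex w & forall i, 0 < w i -> A i w.
Proof.
(* With one index the doors of Scarf's lemma would be empty; the simplex is then a single point. *)
have [I_gt1|] := boolP (1 < #|I|)%N; last first.
  rewrite -leqNgt leq_eqVlt ltnS leqn0 eqn0Ngt I_gt0 orbF => /eqP/mem_card1[i0 I0].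
  have s1 : simplex (fun _ : I => 1 : R).
    split=> //; rewrite (big_pred1 i0) // => i; by have := I0 i; rewrite !inE.
  exists (fun _ : I => 1 : R) => // i _; have [j] := A_cover s1.
  by have := I0 i; have := I0 j; rewrite !inE => /esym/eqP-> /esym/eqP->.
pose pt n (x : grid_point I n.+1) : I -> R := fun i => (grid_coord x i)%:R / n.+1%:R.
have ptP n x : simplex (@pt n x).
  split=> [i|]; first by rewrite divr_ge0.
  by rewrite -mulr_suml -natr_sum grid_sum divff.
have main n : exists (w : I -> R) (z : I -> I -> R),
    [/\ simplex w, forall i, simplex (z i),
        forall i j, `|z i j - w j| <= #|I|%:R / n.+1%:R
      & forall i, #|I|%:R / n.+1%:R < w i -> A i (z i)].
  have [col hcol] := choice (fun x => A_cover (ptP n x)).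
  have [S [C [[x xS] colS smallS closeS]]] := scarf_grid col I_gt1.
  have zex i : exists y, y \in S /\ (i \in C -> col y = i).
    by have [/colS[y yS yi]|_] := boolP (i \in C); [exists y|exists x].
  have [z hz] := choice zex.
  exists (pt n x), (fun i => pt n (z i)); split=> //.
  - move=> i j; have [ziS _] := hz i; rewrite /pt -mulrBl normrM normfV.
    rewrite normr_nat ler_pM2r ?invr_gt0 // ler_norml.
    have := closeS _ _ j ziS xS; have := closeS _ _ j xS ziS.
    rewrite -!(ltr_nat R) !natrD; lra.
  - move=> i; have [ziS zi] := hz i; rewrite ltr_pM2r ?invr_gt0 // ltr_nat => xi.
    have iC : i \in C.
      by apply: contraLR xi => iC; rewrite -leqNgt ltnW // smallS.
    by rewrite -{1}(zi iC); exact: hcol.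
have [w {}main] := choice main.
have [z {}main] := choice main.
have small : (#|I|%:R / n.+1%:R : R) @[n --> U] --> 0.
  rewrite -[0](mulr0 #|I|%:R); apply: cvgMr.
  exact: cvg_trans (cvg_app _ U_oo) (@cvg_harmonic R).
have lex j : exists x : R, 0 <= x /\ w n j @[n --> U] --> x.
  have w01 n : 0 <= w n j <= 1.
    have [[w0 w1] _ _ _] := main n; rewrite w0 /= -w1 (bigD1 j) //=.
    by rewrite lerDl sumr_ge0.
  have w01U : \forall n \near U, 0 <= w n j <= 1 by apply: filterE.
  by have [x /andP[x0 _] wx] := ultra_cvg_itv w01U; exists x.
have [l lU] := choice lex.
have zU i j : z n i j @[n --> U] --> l j.
  rewrite -[l j]add0r.
  have -> : (fun n => z n i j) = (fun n => (z n i j - w n j) + w n j).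
    by apply/funext => n; rewrite subrK.
  apply: cvgD; last by have [] := lU j.
  apply/cvgr0Pnorm_lt => e e0; move/cvgr0Pnorm_lt : small => /(_ e e0).
  apply: filterS => n; apply: le_lt_trans; have [_ _ zw _] := main n.
  exact: le_trans (zw i j) (ler_norm _).
have sl : simplex l.
  split=> [j|]; first by have [] := lU j.
  have : \sum_i w n i @[n --> U] --> \sum_i l i.
    apply: cvg_big => [|i _]; last by have [] := lU i.
    exact: add_continuous.
  have -> : (fun n => \sum_i w n i) = cst 1.
    by apply/funext => n; have [[_ ->]] := main n.
  by move=> /(cvg_unique _); apply; [exact: Rhausdorff|exact: cvg_cst].
exists l => // i li; apply: (A_closed (w_ := fun n => z n i)) => //.
 by move=> n; have [] := main n.
have : \forall n \near U, 0 < w n i - #|I|%:R / n.+1%:R.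
  have : w n i - #|I|%:R / n.+1%:R @[n --> U] --> l i - 0.
    by apply: cvgB => //; have [] := lU i.
  by rewrite subr0 => /cvgr_gt; apply.
by apply: filterS => n; rewrite subr_gt0; have [_ _ _] := main n; apply.
Qed.
End DualKKM.

(** * Value function and optimal paths *)

Section Nodes.
Variable N : nat.
Implicit Types p q : node N.

(** The number of switches left before the top node, used as the measure of inductions on nodes. *)
Definition zeros p : nat := N - \sum_(i < N) p i.

Lemma ones_le p : (\sum_(i < N) p i <= N)%N.
Proof.
rewrite -[leqRHS]card_ord -sum1_card; apply: leq_sum => i _; exact: leq_b1.
Qed.

Lemma next_zeros p q : next_node p q -> zeros p = (zeros q).+1.
Proof.
case/existsP=> i /andP[pi /eqP qE].
have qp : (\sum_(k < N) q k)%N = (\sum_(k < N) p k).+1.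
  rewrite (bigD1 i) // [in RHS](bigD1 i) //= qE ffunE eqxx (negbTE pi) add0n add1n.
  by congr _.+1; apply: eq_bigr => k ki; rewrite ffunE (negbTE ki).
by have := ones_le q; rewrite /zeros qp; lia.
Qed.

Lemma next_exists p : p != top_node N -> exists q, next_node p q.
Proof.
move=> ptop; have [i pi] : exists i, ~~ p i.
  apply/existsP; apply: contraNT ptop => /existsPn h; apply/eqP/ffunP => i.
  by rewrite ffunE; have := h i; rewrite negbK.
by exists [ffun k => (k == i) || p k]; apply/existsP; exists i; rewrite pi eqxx.
Qed.

Lemma next_neq_top p q : next_node p q -> p != top_node N.
Proof.
by case/existsP=> i /andP[+ _]; apply: contraNneq => ->; rewrite ffunE.
Qed.

Lemma zeros_eq0 p : (zeros p == 0)%N = (p == top_node N).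
Proof.
apply/eqP/eqP => [z0|->].
  apply/eqP; apply: contraT => /next_exists[q /next_zeros].
  by rewrite z0.
rewrite /zeros; under eq_bigr do rewrite ffunE.
by rewrite sum1_card card_ord subnn.
Qed.

End Nodes.

Section Value.
Variables (R : realType) (N : nat) (T : R).
Variable C : node N -> node N -> R -> R -> (node N -> L2 T) -> R.
Variable Cf : node N -> R -> R.
Implicit Types (p q : node N) (s t e v : R) (c : control R N) (rho : node N -> L2 T).

Lemma admissible_nil p (t : R) : p = top_node N \/ t = T -> admissible T p t [::].
Proof. by split. Qed.

(** Removing the first switch lowers both the length and its maximum by one. With an empty tail at a
    node other than the top one, the length 1 is below the maximum, which forces [s = T]: this is
    when the empty control is allowed. *)
Lemma admissible_cons p (t : R) q s c : t < T ->
  admissible T p t ((q, s) :: c) <->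
  [/\ next_node p q, t < s, s <= T & admissible T q s c].
Proof.
move=> tT; rewrite /admissible -!/(zeros _) /=; split.
  case=> sz /andP[/andP[pq ts] pc] /andP[sT cT] lastT _.
  have pqz := next_zeros pq; rewrite pqz in sz lastT; split=> //; split=> //.
    by move=> /andP[c1 cz]; apply: lastT; rewrite ltnS cz.
  move=> c0; have [qtop|] := eqVneq q (top_node N); first by left.
  rewrite -zeros_eq0 => qz; right; move: lastT; rewrite (size0nil c0) /=; apply.
  by move: qz; lia.
case=> pq ts sT [sz pc cT lastT c0]; have pqz := next_zeros pq; rewrite pqz.
split=> //; first by rewrite pq ts.
  by rewrite sT.
move=> /=; rewrite ltnS => cz.
have [c1|] := posnP (size c); last by move=> c1; apply: lastT; rewrite c1.
have [qtop|->] := c0 c1; last by rewrite (size0nil c1).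
by move: cz; rewrite c1 => /lt0n_neq0; rewrite zeros_eq0 qtop eqxx.
Qed.

Lemma J_stop p t c rho : p = top_node N \/ t = T -> J C Cf p t c rho = Cf p t.
Proof. by rewrite /J => -[]->; rewrite ?eqxx ?ltxx ?andbF. Qed.

Lemma J_cons p t q s c rho : t < T -> admissible T p t ((q, s) :: c) ->
  J C Cf p t ((q, s) :: c) rho = C p q t s rho + J C Cf q s c rho.
Proof.
move=> tT /(admissible_cons _ _ _ _ tT)[pq ts sT adm].
rewrite {1}/J (next_neq_top pq) tT /= big_ord_recl /= -addrA; congr (_ + _).
have nthE i : (i <= size c)%N -> nth (p, t) ((q, s) :: c) i = nth (q, s) ((q, s) :: c) i.
  by move=> ic; apply: set_nth_default.
have -> : nth (p, t) ((q, s) :: c) (size c) = nth (q, s) ((q, s) :: c) (size c).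
  exact: nthE.
rewrite /J; case: ifPn => [_|].
  congr (_ + _); apply: eq_bigr => i _; rewrite /bump /= add0n nthE; last exact: ltnW.
  by rewrite (set_nth_default (q, s)) //.
(* At a stopping point [J] returns the final cost for any control; the sum agrees because only the
   empty control is admissible there. *)
have c0 : q = top_node N \/ s = T -> c = [::].
  case: adm => sz pc cT _ _ [qtop|sT'].
    move: sz; rewrite -/(zeros _) qtop; have := zeros_eq0 (top_node N).
    by rewrite eqxx => /eqP ->; rewrite leqn0 size_eq0 => /eqP.
  case: c {nthE sz} pc cT => //= -[q' s'] c /andP[/andP[_ /= ss'] _] /andP[s'T _].
  by move: ss'; rewrite sT' ltNge s'T.
rewrite negb_and negbK -leNgt => qs; rewrite c0 ?big_ord0 ?add0r //.
by case/orP: qs => [/eqP|Ts]; [left|right; apply/le_anti; rewrite sT].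
Qed.

Hypothesis T_gt0 : 0 < T.
Hypothesis C_ge0 : cost_nonneg C.
Hypothesis Cf_reg : final_cost_regular T Cf.

Lemma Cf_bounded : exists M, forall p t, 0 <= t <= T -> `|Cf p t| <= M.
Proof.
have Mp p : exists M, forall t, 0 <= t <= T -> `|Cf p t| <= M.
  have [[M [_ hM]] _] := Cf_reg p; exists (M + 1) => t tT.
  by apply: (hM (M + 1)); rewrite ?ltrDl // /= in_itv.
have [M hM] := choice Mp; exists (\sum_p `|M p|) => p t tT; apply: le_trans (hM p t tT) _; apply: le_trans (ler_norm _) _.
by rewrite (bigD1 p) //= lerDl sumr_ge0.
Qed.

Lemma Cf_lipschitz p : exists2 K, 0 <= K &
  forall t t', 0 <= t <= T -> 0 <= t' <= T -> `|Cf p t - Cf p t'| <= K * `|t - t'|.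
Proof.
have [_ [K [_ hK]]] := Cf_reg p; exists (`|K| + 1); first by rewrite addr_ge0.
move=> t t' tT t'T; have KK : K < `|K| + 1.
  by rewrite (le_lt_trans (ler_norm K)) // ltrDl.
by have := hK _ KK (t, t'); apply; split; rewrite /= in_itv.
Qed.

(** Since switching costs are nonnegative, [- M] is a lower bound for [J] and [V]. *)
Let M := sval (cid Cf_bounded).
Let M_bound p t : 0 <= t <= T -> `|Cf p t| <= M.
Proof. exact: (svalP (cid Cf_bounded)). Qed.

Lemma J_ge p t c rho : masses rho -> 0 <= t <= T -> admissible T p t c ->
  - M <= J C Cf p t c rho.
Proof.
move=> rhoM; elim: c p t => [|[q s] c ih] p t /andP[t0 tT] adm.
  rewrite J_stop; last by case: adm => _ _ _ _; apply.
  by apply: lerNnormlW; apply: M_bound; rewrite t0.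
have {}tT : t < T.
  by case: adm => _ /= /andP[/andP[_ /= ts] _] /andP[sT _] _ _; apply: lt_le_trans sT.
rewrite J_cons //; move/(admissible_cons _ _ _ _ tT): adm => [pq ts sT adm].
rewrite -[- M]add0r lerD ?C_ge0 ?ih // sT (le_trans t0) //; exact: ltW.
Qed.

Lemma V_has_inf p t rho : masses rho -> 0 <= t <= T ->
  has_inf [set J C Cf p t c rho | c in admissible T p t].
Proof.
move=> rhoM tT; split; last first.
  by exists (- M) => _ [c adm <-]; apply: J_ge.
have [pt|] := pselect (p = top_node N \/ t = T).
  by exists (J C Cf p t [::] rho), [::] => //; apply: admissible_nil.
move=> /not_orP[/eqP ptop /eqP tneT]; have [q pq] := next_exists ptop.
have {}tT : t < T by rewrite lt_neqAle tneT; case/andP: tT.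
exists (J C Cf p t [:: (q, T)] rho), [:: (q, T)] => //; apply/admissible_cons => //.
by split=> //; apply: admissible_nil; right.
Qed.

Lemma V_stop p t rho : p = top_node N \/ t = T -> V C Cf p t rho = Cf p t.
Proof.
move=> pt; rewrite /V (_ : image _ _ = [set Cf p t]) ?inf1 //.
apply/seteqP; split=> [_ [c _ <-]|_ ->]; first exact: J_stop.
by exists [::]; [exact: admissible_nil|exact: J_stop].
Qed.

Lemma V_ge p t rho : masses rho -> 0 <= t <= T -> - M <= V C Cf p t rho.
Proof.
move=> rhoM tT; apply: lb_le_inf; first by have [] := V_has_inf p rhoM tT.
by move=> _ [c adm <-]; apply: J_ge.
Qed.

Definition switch_cost p t rho (z : node N * R) : R :=
  C p z.1 t z.2 rho + V C Cf z.1 z.2 rho.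

(** Half of the dynamic programming principle: a switch followed by any continuation is a
    control. *)
Lemma V_le_switch p t q s rho : masses rho -> 0 <= t -> next_node p q -> t < s ->
  s <= T -> V C Cf p t rho <= switch_cost p t rho (q, s).
Proof.
move=> rhoM t0 pq ts sT; have tT : t < T := lt_le_trans ts sT.
have s0T : 0 <= s <= T by rewrite sT (le_trans t0) // ltW.
rewrite /switch_cost /= -lerBlDl; apply: lb_le_inf.
  by have [] := V_has_inf q rhoM s0T.
move=> _ [c adm <-]; rewrite lerBlDl -J_cons //; last exact/admissible_cons.
apply: ge_inf; first by have [] := V_has_inf p rhoM (t := t); rewrite ?t0 ?ltW.
by exists ((q, s) :: c) => //; apply/admissible_cons.
Qed.

(** The other half, up to [e] because nothing is known yet about attainment: the first switch of an
    almost optimal control. *)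
Lemma V_switch_adherent p t rho e : masses rho -> 0 <= t < T -> p != top_node N ->
  0 < e -> exists z, [/\ next_node p z.1, t < z.2, z.2 <= T
    & switch_cost p t rho z <= V C Cf p t rho + e].
Proof.
move=> rhoM /andP[t0 tT] ptop e0; have tT' : 0 <= t <= T by rewrite t0 ltW.
have [_ [c adm <-]] := inf_adherent e0 (V_has_inf p rhoM tT').
case: c adm => [|[q s] c] adm.
  case: adm => _ _ _ _ /(_ erefl)[/eqP|tT'']; first by rewrite (negbTE ptop).
  by rewrite tT'' ltxx in tT.
rewrite J_cons // => /ltW Jle; have [pq ts sT adm'] := (admissible_cons _ _ _ _ tT).1 adm.
exists (q, s); split=> //; apply: le_trans Jle; rewrite /switch_cost lerD2l.
have s0T : 0 <= s <= T by rewrite sT (le_trans t0) // ltW.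
by apply: ge_inf; [have [] := V_has_inf q rhoM s0T|exists c].
Qed.

Lemma opt_switchP p t rho z : masses rho -> 0 <= t -> opt_switch C Cf rho p t z ->
  [/\ next_node p z.1, t < z.2, z.2 <= T, p != top_node N
    & switch_cost p t rho z <= V C Cf p t rho].
Proof.
move=> rhoM t0 [[ptop tT pz /andP[tz zT]] zmin]; split=> //.
apply/ler_addgt0Pr => e e0; have t0T : 0 <= t < T by rewrite t0.
have [z' [pz' tz' z'T cost]] := V_switch_adherent rhoM t0T ptop e0.
apply: le_trans cost; rewrite /switch_cost addrC [leRHS]addrC.
by apply: zmin; split=> //; rewrite tz'.
Qed.

Hypothesis C_reg : cost_regular C.
Hypothesis C_dec : cost_decreasing C.
Hypothesis C_blow : cost_blowup C.
Hypothesis C_cont : cost_continuous C.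

(** * Limits of switches and of optimal paths *)

Section Limits.
Variables (U : set_system nat).
Context {UU : UltraFilter U}.
Variables (rho_ : nat -> node N -> L2 T) (rho : node N -> L2 T).
Hypothesis rho_M : forall n, masses (rho_ n).
Hypothesis rhoM : masses rho.
Hypothesis rhoU : L2dist (rho_ n) rho @[n --> U] --> 0.

(** The Lipschitz constant may degenerate as the decision time approaches the arrival time, so it is
    used at a fixed distance [h]. Both terms have the arrival time [s_ n]: only the decision time
    and the masses vary. *)
Lemma C_lip p q t s (t_ s_ : nat -> R) e : next_node p q ->
  t_ n @[n --> U] --> t -> s_ n @[n --> U] --> s ->
  (\forall n \near U, 0 <= t_ n) -> (\forall n \near U, s_ n <= T) ->
  t < s -> 0 < e ->
  \forall n \near U, `|C p q (t_ n) (s_ n) (rho_ n) - C p q t (s_ n) rho| <= e.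
Proof.
move=> pq tU sU t0 sT ts e0; have [h0 h0_gt0 hC] := C_reg.
(* Each time moves by less than [h], a third of the gap, so a gap of at least [h] remains; [h0 / 2]
   keeps [h] below [h0]. *)
pose h := Num.min (h0 / 2) ((s - t) / 3).
have h_gt0 : 0 < h by rewrite lt_min !divr_gt0 ?subr_gt0.
have hst : h <= (s - t) / 3 by rewrite ge_min lexx orbT.
have [|B [K hBK]] := hC h.
  by rewrite h_gt0 gt_min; apply/orP; left; lra.
have K1 : 0 < `|K| + 1 by rewrite ltr_wpDl.
have tt0 : 0 <= t := cvg_near_ge (UU := UU) tU t0.
have tclose : \forall n \near U, `|t - t_ n| < Num.min h (e / (`|K| + 1) / 2).
  by move/cvgrPdist_lt : tU; apply; rewrite lt_min h_gt0 !divr_gt0.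
have sclose : \forall n \near U, `|s - s_ n| < h.
  by move/cvgrPdist_lt : sU; apply.
have rclose : \forall n \near U, `|0 - L2dist (rho_ n) rho| < e / (`|K| + 1) / 2.
  by move/cvgrPdist_lt : rhoU; apply; rewrite !divr_gt0.
near=> n.
have : `|t - t_ n| < Num.min h (e / (`|K| + 1) / 2) by near: n.
rewrite lt_min => /andP[th te].
have sh : `|s - s_ n| < h by near: n.
have re : `|0 - L2dist (rho_ n) rho| < e / (`|K| + 1) / 2 by near: n.
have tn0 : 0 <= t_ n by near: n.
have snT : s_ n <= T by near: n.
have [|_ lipC] := hBK p q (s_ n) pq.
  rewrite snT andbT; move: sh; rewrite ltr_norml; lra.
have tn : 0 <= t_ n <= s_ n - h.
  move: th sh; rewrite !ltr_norml tn0 /=; lra.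
have tn' : 0 <= t <= s_ n - h by move: sh; rewrite ltr_norml tt0 /=; lra.
apply: le_trans (lipC _ _ _ _ tn tn' (rho_M n) rhoM) _.
rewrite distrC in te; rewrite sub0r normrN in re.
have d0 : 0 <= L2dist (rho_ n) rho by exact: sqrtr_ge0.
rewrite ger0_norm // in re.
have : `|t_ n - t| + L2dist (rho_ n) rho <= e / (`|K| + 1) by lra.
rewrite ler_pdivlMr // mulrC; apply: le_trans.
apply: ler_wpM2r; first by rewrite addr_ge0.
by apply: le_trans (ler_norm K) _; rewrite lerDl.
Unshelve. all: by end_near. Qed.

Lemma C_lsc p q t s (t_ s_ : nat -> R) e : next_node p q ->
  t_ n @[n --> U] --> t -> s_ n @[n --> U] --> s ->
  (\forall n \near U, 0 <= t_ n) -> (\forall n \near U, s_ n <= T) ->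
  t < s -> 0 < e ->
  \forall n \near U, C p q t s rho <= C p q (t_ n) (s_ n) (rho_ n) + e.
Proof.
move=> pq tU sU t0 sT ts e0; have e2 : 0 < e / 2 by rewrite divr_gt0.
have tt0 : 0 <= t := cvg_near_ge (UU := UU) tU t0.
have Cts : \forall n \near U, C p q t s rho <= C p q t (s_ n) rho + e / 2.
  have sn_t : \forall n \near U, t < s_ n by move/cvgr_gt : sU; apply.
  have tT : t < T.
    by have [n [tn snT]] := filter_ex (filterI sn_t sT); apply: lt_le_trans tn snT.
  have t0T : 0 <= t < T by rewrite tt0.
  have sleT : s <= T.
    have s01 : \forall n \near U, t <= s_ n <= T.
      by apply: filterS2 sn_t sT => n /ltW -> ->.
    by have /andP[] := cvg_near_itv (UU := UU) sU s01.
  have [sT'|Ts] := ltP s T.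
    have st : s \in `]t, T[ by rewrite in_itv /= ts.
    have /(_ _ st) cs := C_cont pq t0T rhoM.
    have /cvgrPdist_le/(_ _ e2) := cvg_comp _ _ sU cs.
    by apply: filterS => n /=; rewrite ler_norml; lra.
  (* [C] need not be left-continuous at T, but it can only jump down there. *)
  have -> : s = T by apply/le_anti; rewrite sleT.
  near=> n.
  apply: (@le_trans _ _ (C p q t (s_ n) rho)); last by rewrite lerDl ltW.
  by apply: (C_dec pq t0T rhoM) => //; near: n.
have Cn := C_lip pq tU sU t0 sT ts e2.
by apply: filterS2 Cts Cn => n; rewrite ler_norml; lra.
Unshelve. all: by end_near. Qed.

(** An almost optimal switch for [rho] is used again for [rho_ n], with the same two times. One
    third of [e] pays for its suboptimality, one for [C] and one for the value at the next node. *)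
Lemma V_usc p t e : 0 <= t <= T -> 0 < e ->
  \forall n \near U, V C Cf p t (rho_ n) <= V C Cf p t rho + e.
Proof.
have [k] := ubnP (zeros p); elim: k p t e => // k ih p t e pk tT e0.
have [pt|] := pselect (p = top_node N \/ t = T).
  by near=> n; rewrite !V_stop // lerDl ltW.
move=> /not_orP[/eqP ptop /eqP tneT].
have {}tT : 0 <= t < T by rewrite lt_neqAle tneT.
have e3 : 0 < e / 3 by rewrite divr_gt0.
have [[q s] /= [pq ts sT Vqs]] := V_switch_adherent rhoM tT ptop e3.
have t0 : 0 <= t by case/andP: tT.
have s0T : 0 <= s <= T by rewrite sT (le_trans t0) // ltW.
have qk : (zeros q < k)%N by rewrite -ltnS -(next_zeros pq).
have Cn : \forall n \near U, `|C p q t s (rho_ n) - C p q t s rho| <= e / 3.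
  apply: (@C_lip p q t s (fun=> t) (fun=> s)) => //; try exact: cvg_cst.
    exact: filterE.
  exact: filterE.
have Vn := ih q s (e / 3) qk s0T e3.
near=> n.
apply: le_trans (V_le_switch (rho_M n) t0 pq ts sT) _.
have : V C Cf q s (rho_ n) <= V C Cf q s rho + e / 3 by near: n.
have : `|C p q t s (rho_ n) - C p q t s rho| <= e / 3 by near: n.
by move: Vqs; rewrite /switch_cost /= ler_norml; lra.
Unshelve. all: by end_near. Qed.

(* As s increases to T, the value tends to +oo at every non-terminal node, while
   at s = T it is the final cost: only lower semicontinuity in time holds. *)
Definition V_lsc_at q := forall s (s_ : nat -> R) e, s_ n @[n --> U] --> s ->
  (\forall n \near U, 0 <= s_ n <= T) -> 0 < e ->
  \forall n \near U, V C Cf q s rho <= V C Cf q (s_ n) (rho_ n) + e.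

(* The blow-up of [C] keeps the switching times apart in the limit. *)
Lemma switch_gap v p q t s (t_ s_ : nat -> R) : next_node p q ->
  t_ n @[n --> U] --> t -> s_ n @[n --> U] --> s ->
  (\forall n \near U, [/\ 0 <= t_ n, t_ n < s_ n, s_ n <= T &
     switch_cost p (t_ n) (rho_ n) (q, s_ n) <= v]) -> t < s.
Proof.
(* As [V] is at least [- M], a switch cost of at most [v] bounds [C] by [v + M], which is impossible
   within [d] of the decision time. *)
move=> pq tU sU h; have [d d0 blow] := C_blow (v + M).
have gap : \forall n \near U, t_ n + d <= s_ n.
  apply: filterS h => n [t0 ts sT cost]; rewrite leNgt; apply/negP => sd.
  have t0T : 0 <= t_ n < T by rewrite t0 (lt_le_trans ts).
  have := blow p q (t_ n) (rho_ n) (s_ n) pq t0T (rho_M n) ts sT sd.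
  have : - M <= V C Cf q (s_ n) (rho_ n).
    by apply: V_ge => //; rewrite sT (le_trans t0) // ltW.
  move: cost; rewrite /switch_cost /=; lra.
have : 0 <= s - t - d <= s - t - d + 1.
  have U0 : s_ n - t_ n - d @[n --> U] --> s - t - d.
    by apply: cvgB (cvg_cst _); apply: cvgB.
  apply: (cvg_near_itv (UU := UU) U0); near=> n; apply/andP; split.
    by rewrite subr_ge0 lerBrDl; near: n.
  by near: n; move/cvgr_le : U0; apply; rewrite ltrDl.
lra.
Unshelve. all: by end_near. Qed.

(** Lower semicontinuity at [q] is a premise so that the lemma can also serve inside the induction
    that proves it. *)
Lemma switch_limit v p q t s (t_ s_ : nat -> R) : next_node p q -> V_lsc_at q ->
  t_ n @[n --> U] --> t -> s_ n @[n --> U] --> s ->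
  (\forall n \near U, [/\ 0 <= t_ n, t_ n < s_ n, s_ n <= T &
     switch_cost p (t_ n) (rho_ n) (q, s_ n) <= v]) ->
  switch_cost p t rho (q, s) <= v.
Proof.
move=> pq Vq tU sU h; have ts := switch_gap pq tU sU h.
apply/ler_addgt0Pr => e e0; have e2 : 0 < e / 2 by rewrite divr_gt0.
have t0 : \forall n \near U, 0 <= t_ n by apply: filterS h => n [].
have sT : \forall n \near U, s_ n <= T by apply: filterS h => n [].
have s0T : \forall n \near U, 0 <= s_ n <= T.
  by apply: filterS h => n [tn0 tsn -> _]; rewrite andbT (le_trans tn0) // ltW.
have Cn := C_lsc pq tU sU t0 sT ts e2.
have Vn := Vq _ _ _ sU s0T e2.
have [n [[[_ _ _ cost] Cle] Vle]] := filter_ex (filterI (filterI h Cn) Vn).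
move: cost; rewrite /switch_cost /=; lra.
Qed.

(** At the top node this is the continuity of the final cost. Elsewhere a failure would give
    switches from [(p, t_ n)] of cost at most [V C Cf p t rho - e / 2], and their limit would be a
    switch from [(p, t)] cheaper than the value. *)
Lemma V_lsc p : V_lsc_at p.
Proof.
have [k] := ubnP (zeros p); elim: k p => // k ih p pk t t_ e tU t0T e0.
have tT := cvg_near_itv (UU := UU) tU t0T.
have [ptop|ptop] := eqVneq p (top_node N).
  have [K K0 lipK] := Cf_lipschitz p.
  have K1 : 0 < K + 1 by rewrite ltr_wpDl.
  have tclose : \forall n \near U, `|t - t_ n| < e / (K + 1).
    by move/cvgrPdist_lt : tU; apply; rewrite divr_gt0.
  near=> n; rewrite !V_stop; [|by left..].
  have tnT : 0 <= t_ n <= T by near: n.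
  rewrite -lerBlDl; apply: le_trans (ler_norm _) _; apply: le_trans (lipK _ _ tT tnT) _.
  have : `|t - t_ n| < e / (K + 1) by near: n.
  rewrite ltr_pdivlMr // => /ltW; apply: le_trans.
  by rewrite mulrC ler_wpM2l // lerDl.
apply: contrapT => /ultra_not notle.
(* If [t_ n = T] for almost all [n], then [t = T] and both values are the final cost. Otherwise
   [t_ n < T], and [switch_gap] will exclude the limit [t = T]. *)
have [tnT|tnT] := in_ultra_setVsetC [set n | t_ n = T] UU.
  have tT' : t = T.
    have : \forall n \near U, T <= t_ n <= T by apply: filterS tnT => n /= ->; rewrite lexx.
    by move/(cvg_near_itv (UU := UU) tU)/andP => [? ?]; apply/le_anti/andP.
  have [n [nle /= tn]] := filter_ex (filterI notle tnT); apply: nle.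
  by rewrite !V_stop; [rewrite tT' tn lerDl ltW|right..].
have e2 : 0 < e / 2 by rewrite divr_gt0.
have zex n : exists z, 0 <= t_ n < T -> [/\ next_node p z.1, t_ n < z.2, z.2 <= T
    & switch_cost p (t_ n) (rho_ n) z <= V C Cf p (t_ n) (rho_ n) + e / 2].
  have [tn|ntn] := pselect (0 <= t_ n < T); last by exists (p, 0) => /ntn.
  by have [z hz] := V_switch_adherent (rho_M n) tn ptop e2; exists z.
have [z hz] := choice zex.
have zP : \forall n \near U, [/\ next_node p (z n).1, 0 <= t_ n, t_ n < (z n).2, (z n).2 <= T
    & switch_cost p (t_ n) (rho_ n) (z n) <= V C Cf p t rho - e / 2].
  near=> n; have /andP[tn0 tnT'] : 0 <= t_ n <= T by near: n.
  have tn : 0 <= t_ n < T.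
    rewrite tn0 lt_neqAle tnT' andbT; apply/eqP; near: n; exact: tnT.
  have [pz tz zT cost] := hz n tn; split=> //.
  have /negP : ~ V C Cf p t rho <= V C Cf p (t_ n) (rho_ n) + e by near: n.
  by rewrite -ltNge; lra.
have [q zq] := ultra_finite (UU := UU) (fun n => (z n).1).
have [s _ sU] : exists2 s, 0 <= s <= T & (z n).2 @[n --> U] --> s.
  apply: ultra_cvg_itv; apply: filterS zP => n [_ tn0 tz zT _].
  by rewrite zT (le_trans tn0) // ltW.
have zP' : \forall n \near U, [/\ 0 <= t_ n, t_ n < (z n).2, (z n).2 <= T
    & switch_cost p (t_ n) (rho_ n) (q, (z n).2) <= V C Cf p t rho - e / 2].
  by apply: filterS2 zq zP => n <- [_]; case: (z n).
have pq : next_node p q by have [n [<- []]] := filter_ex (filterI zq zP).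
have qk : (zeros q < k)%N by rewrite -ltnS -(next_zeros pq).
have ts := switch_gap pq tU sU zP'.
have sT : s <= T.
  have sT' : \forall n \near U, t <= (z n).2 <= T.
    near=> n; have [_ _ _ -> _] : [/\ next_node p (z n).1, 0 <= t_ n, t_ n < (z n).2, (z n).2 <= T
      & switch_cost p (t_ n) (rho_ n) (z n) <= V C Cf p t rho - e / 2] by near: n.
    by rewrite andbT; apply: ltW; near: n; move/cvgr_gt : sU; apply.
  by have /andP[] := cvg_near_itv (UU := UU) sU sT'.
have := switch_limit pq (ih q qk) tU sU zP'.
have := V_le_switch rhoM (proj1 (andP tT)) pq ts sT.
lra.
Unshelve. all: by end_near. Qed.

Lemma nearest_limit m x s (s_ : nat -> R) : s_ n @[n --> U] --> s ->
  (\forall n \near U, nearest T m (s_ n) x) -> nearest T m s x.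
Proof.
move=> sU near_x; split; first by have [n []] := filter_ex near_x.
move=> y gy; apply/ler_addgt0Pr => e e0; have e2 : 0 < e / 2 by rewrite divr_gt0.
move/cvgrPdist_lt : sU => /(_ _ e2) sU.
have [n [sn [_ /(_ y gy) xy]]] := filter_ex (filterI sU near_x).
have xs : `|x - s| <= `|x - s_ n| + `|s - s_ n|.
  by rewrite (distrC s); exact: ler_distD.
have ys : `|y - s_ n| <= `|y - s| + `|s - s_ n| by exact: ler_distD.
lra.
Qed.

(** The nodes and grid times of [ce] are fixed, so only the true switching times depend on [n] and
    have to converge. The bound [v] on the values is what [switch_gap] requires at each step. *)
Lemma path_limit (m : nat) (ce : control R N) v p t (t_ : nat -> R)
    (c_ : nat -> control R N) :
  t_ n @[n --> U] --> t ->
  (\forall n \near U, 0 <= t_ n <= T) ->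
  (\forall n \near U, V C Cf p (t_ n) (rho_ n) <= v) ->
  (\forall n \near U,
    [/\ path (fun a b => b \in opt_switch C Cf (rho_ n) a.1 a.2) (p, t_ n) (c_ n),
        (last (p, t_ n) (c_ n)).1 = top_node N \/ (last (p, t_ n) (c_ n)).2 = T,
        unzip1 ce = unzip1 (c_ n)
      & all2 (fun se s => se \in nearest T m s) (unzip2 ce) (unzip2 (c_ n))]) ->
  exists c,
    [/\ path (fun a b => b \in opt_switch C Cf rho a.1 a.2) (p, t) c,
        (last (p, t) c).1 = top_node N \/ (last (p, t) c).2 = T,
        unzip1 ce = unzip1 c
      & all2 (fun se s => se \in nearest T m s) (unzip2 ce) (unzip2 c)].
Proof.
elim: ce p t t_ c_ => [|[q x] ce ih] p t t_ c_ tU t0T Vv hc.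
  exists [::]; split=> //=.
  have : \forall n \near U, p = top_node N \/ t_ n = T.
    by apply: filterS hc => n [_ + c0 _]; case: (c_ n) c0.
  case/ultra_or => [/filter_ex[]|tT]; [by left|right].
  have : \forall n \near U, T <= t_ n <= T by apply: filterS tT => n ->; rewrite lexx.
  by move/(cvg_near_itv (UU := UU) tU)/andP => [? ?]; apply/le_anti/andP.
pose s_ n := (head (p, 0) (c_ n)).2.
have {hc} hc : \forall n \near U, opt_switch C Cf (rho_ n) p (t_ n) (q, s_ n) /\
    nearest T m (s_ n) x /\
    [/\ path (fun a b => b \in opt_switch C Cf (rho_ n) a.1 a.2) (q, s_ n) (behead (c_ n)),
        (last (q, s_ n) (behead (c_ n))).1 = top_node N \/
        (last (q, s_ n) (behead (c_ n))).2 = T,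
        unzip1 ce = unzip1 (behead (c_ n))
      & all2 (fun se s => se \in nearest T m s) (unzip2 ce) (unzip2 (behead (c_ n)))].
  apply: filterS hc => n; rewrite /s_; case: (c_ n) => [|[q' s'] c] /= [] //.
  move=> /andP[qs' cpath] clast [qq' c1] /andP[xs call]; subst q'.
  by split; [exact: set_mem|split; [exact: set_mem|]].
have optn : \forall n \near U, [/\ 0 <= t_ n <= T, opt_switch C Cf (rho_ n) p (t_ n) (q, s_ n)
    & V C Cf p (t_ n) (rho_ n) <= v].
  by near=> n; split; near: n => //; apply: filterS hc => n [].
have sP : \forall n \near U, [/\ 0 <= t_ n, t_ n < s_ n, s_ n <= T
    & switch_cost p (t_ n) (rho_ n) (q, s_ n) <= v].
  apply: filterS optn => n [/andP[tn0 _] opt Vle].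
  have [_ /= -> -> _ cost] := opt_switchP (rho_M n) tn0 opt.
  by split=> //; apply: le_trans cost Vle.
have s0T : \forall n \near U, 0 <= s_ n <= T.
  by apply: filterS sP => n [tn0 /ltW/(le_trans tn0)-> -> _].
have [s sT sU] := ultra_cvg_itv s0T.
have [pq ptop] : next_node p q /\ p != top_node N.
  have [n [/andP[tn0 _] opt _]] := filter_ex optn.
  by have [] := opt_switchP (rho_M n) tn0 opt.
have ts := switch_gap pq tU sU sP.
have [c [cpath clast c1 call]] : exists c,
    [/\ path (fun a b => b \in opt_switch C Cf rho a.1 a.2) (q, s) c,
        (last (q, s) c).1 = top_node N \/ (last (q, s) c).2 = T,
        unzip1 ce = unzip1 c
      & all2 (fun se s => se \in nearest T m s) (unzip2 ce) (unzip2 c)].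
  (* Switching costs are nonnegative, so the next node inherits the bound [v]. *)
  apply: (ih q s s_ (fun n => behead (c_ n)) sU s0T); last first.
    by apply: filterS hc => n [_ []].
  apply: filterS sP => n [tn0 tsn snT]; rewrite /switch_cost /=.
  have := C_ge0 pq tn0 tsn snT (rho_M n); lra.
have /andP[t0 tT] := cvg_near_itv (UU := UU) tU t0T; have /andP[s0 sleT] := sT.
have sx : nearest T m s x by apply: nearest_limit sU _; apply: filterS hc => n [_ []].
exists ((q, s) :: c); split=> //=; last by rewrite mem_set.
  rewrite cpath andbT; apply: mem_set; split.
    by split=> //; [exact: lt_le_trans sleT|rewrite ts].
  move=> [q' s'] [_ tT' /= pq' /andP[ts' s'T]].
  rewrite addrC [leRHS]addrC.
  change (switch_cost p t rho (q, s) <= switch_cost p t rho (q', s')).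
  apply/ler_addgt0Pr => e e0; have e2 : 0 < e / 2 by rewrite divr_gt0.
  (* The bound is now the cost of the competitor plus [e]. Since [t_ n] tends to [t < s'], the
     competitor is still feasible for almost all [n]. *)
  apply: (switch_limit pq (@V_lsc q) tU sU).
  have tn0 : \forall n \near U, 0 <= t_ n by apply: filterS t0T => n /andP[].
  have Cn : \forall n \near U, `|C p q' (t_ n) s' (rho_ n) - C p q' t s' rho| <= e / 2.
    apply: (@C_lip p q' t s' t_ (fun=> s')) => //; first exact: cvg_cst.
    exact: filterE.
  have s'0T : 0 <= s' <= T by rewrite s'T (le_trans t0) // ltW.
  have Vn := V_usc q' s'0T e2.
  have tn_s' : \forall n \near U, t_ n < s' by move/cvgr_lt : tU; apply.
  near=> n.
  have [tn0' tsn snT _] : [/\ 0 <= t_ n, t_ n < s_ n, s_ n <= T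
    & switch_cost p (t_ n) (rho_ n) (q, s_ n) <= v] by near: n.
  split=> //.
  have [_ opt _] : [/\ 0 <= t_ n <= T, opt_switch C Cf (rho_ n) p (t_ n) (q, s_ n)
    & V C Cf p (t_ n) (rho_ n) <= v] by near: n.
  have [_ _ _ _ cost] := opt_switchP (rho_M n) tn0' opt.
  apply: le_trans cost _; have tns' : t_ n < s' by near: n.
  apply: le_trans (V_le_switch (rho_M n) tn0' pq' tns' s'T) _.
  have : `|C p q' (t_ n) s' (rho_ n) - C p q' t s' rho| <= e / 2 by near: n.
  have : V C Cf q' s' (rho_ n) <= V C Cf q' s' rho + e / 2 by near: n.
  by rewrite /switch_cost /= ler_norml; lra.
by rewrite c1.
Unshelve. all: by end_near. Qed.

Lemma eps_paths_closed m p pi :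
  (\forall n \near U, eps_paths C Cf m (rho_ n) p pi) -> eps_paths C Cf m rho p pi.
Proof.
move=> hpi; have cex n : exists c, eps_paths C Cf m (rho_ n) p pi -> exists ce,
    [/\ pi = (p, 0) :: ce, optimal_path C Cf (rho_ n) p c, unzip1 ce = unzip1 c
   & all2 (fun se s => se \in nearest T m s) (unzip2 ce) (unzip2 c)].
  have [[c [ce h]]|nh] := pselect (eps_paths C Cf m (rho_ n) p pi); last by exists [::].
  by exists c => _; exists ce.
have [c_ hc] := choice cex.
have [ce piE] : exists ce, pi = (p, 0) :: ce.
  by have [n [c [ce [-> _ _ _]]]] := filter_ex hpi; exists ce.
have T0 : 0 <= (0 : R) <= T by rewrite lexx ltW.
have [c [cpath clast c1 call]] : exists c,
    [/\ path (fun a b => b \in opt_switch C Cf rho a.1 a.2) (p, 0) c,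
        (last (p, 0) c).1 = top_node N \/ (last (p, 0) c).2 = T,
        unzip1 ce = unzip1 c
      & all2 (fun se s => se \in nearest T m s) (unzip2 ce) (unzip2 c)].
  apply: (@path_limit m ce (V C Cf p 0 rho + 1) p 0 (fun=> 0) c_).
  - exact: cvg_cst.
  - exact: filterE.
  - exact: V_usc.
  apply: filterS hpi => n /hc[ce' []]; rewrite piE => -[->] [cpath clast] c1 call.
  by split.
by exists c, ce.
Qed.

End Limits.

Lemma L2dist_refl rho : L2dist rho rho = 0.
Proof.
rewrite /L2dist big1 ?sqrtr0 // => p _.
have -> : (fun x => (rho p x - rho p x)%:E) = cst 0%E by apply/funext => x; rewrite subrr.
by rewrite Lnorm0 // expr0n.
Qed.

Lemma nat_ultrafilter : exists U : set_system nat, UltraFilter U /\ \oo `<=` U.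
Proof. exact: ultraFilterLemma. Qed.

(** Direct method: a minimizing sequence of switches converges along [U], and the results on limits
    apply to the constant sequence of masses. *)
Lemma opt_switch_exists p t rho : masses rho -> 0 <= t < T -> p != top_node N ->
  exists z, opt_switch C Cf rho p t z.
Proof.
move=> rhoM t0T ptop; have /andP[t0 tT] := t0T; have [U [UU U_oo]] := nat_ultrafilter.
have rhoU : L2dist ((fun=> rho) n) rho @[n --> U] --> 0.
  by rewrite L2dist_refl; apply: cvg_cst.
have zex (n : nat) : exists z, [/\ next_node p z.1, t < z.2, z.2 <= T
    & switch_cost p t rho z <= V C Cf p t rho + n.+1%:R^-1].
  by apply: V_switch_adherent.
have [z hz] := choice zex.
have [q zq] := ultra_finite (UU := UU) (fun n => (z n).1).
have pq : next_node p q by have [n <-] := filter_ex zq; have [] := hz n.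
have [s /andP[_ sT] sU] : exists2 s, t <= s <= T & (z n).2 @[n --> U] --> s.
  by apply: ultra_cvg_itv; apply: filterE => n; have [_ /ltW-> ->] := hz n.
have zP e : 0 < e -> \forall n \near U, [/\ 0 <= t, t < (z n).2, (z n).2 <= T &
    switch_cost p t rho (q, (z n).2) <= V C Cf p t rho + e].
  move=> e0; have ne : \forall n \near U, n.+1%:R^-1 < e.
    by apply: U_oo; exact: (near_infty_natSinv_lt (PosNum e0)).
  apply: filterS2 zq ne => n <- ne; have [_ tz zT cost] := hz n; split=> //.
  by rewrite -surjective_pairing (le_trans cost) // lerD2l ltW.
have ts := switch_gap (fun=> rhoM) pq (cvg_cst t) sU (zP 1 ltr01).
exists (q, s); split; first by rewrite ts sT.
move=> z' [_ _ pz' /andP[tz' z'T]] /=.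
rewrite addrC [leRHS]addrC; change (switch_cost p t rho (q, s) <= switch_cost p t rho z').
rewrite (surjective_pairing z'); apply: (le_trans _ (V_le_switch rhoM t0 pz' tz' z'T)).
apply/ler_addgt0Pr => e e0.
apply: (switch_limit (U := U) (fun=> rhoM) rhoM rhoU pq _ (cvg_cst t) sU (zP e e0)).
exact: V_lsc.
Qed.

Lemma optimal_path_exists p t rho : masses rho -> 0 <= t <= T ->
  exists c, path (fun a b => b \in opt_switch C Cf rho a.1 a.2) (p, t) c /\
    ((last (p, t) c).1 = top_node N \/ (last (p, t) c).2 = T).
Proof.
move=> rhoM; have [k] := ubnP (zeros p); elim: k p t => // k ih p t pk tT.
have [pt|/not_orP[/eqP ptop /eqP tneT]] := pselect (p = top_node N \/ t = T).
  by exists [::].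
have {}tT : 0 <= t < T by rewrite lt_neqAle tneT.
have [z zopt] := opt_switch_exists rhoM tT ptop; have /andP[t0 _] := tT.
have [pz tz zT _ _] := opt_switchP rhoM t0 zopt.
have [||c [cpath clast]] := ih z.1 z.2.
- by rewrite -ltnS -(next_zeros pz).
- by rewrite zT (le_trans t0) // ltW.
by exists (z :: c); rewrite /= mem_set // (surjective_pairing z).
Qed.

Lemma nearest_exists m s : exists x, nearest T m s x.
Proof.
pose f (k : 'I_m.+1) : R := `|k%:R * (T / m%:R) - s|.
have [k _ kmin] := @Order.TotalTheory.arg_minP _ _ 'I_m.+1 ord0 xpredT f isT.
exists (k%:R * (T / m%:R)); split; first by exists k => //=; rewrite -ltnS.
by move=> _ [j /= jm <-]; apply: (kmin (Ordinal (jm : (j < m.+1)%N))).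
Qed.

Lemma eps_paths_nonempty m p rho : masses rho -> exists pi, eps_paths C Cf m rho p pi.
Proof.
move=> rhoM; have T0 : 0 <= (0 : R) <= T by rewrite lexx ltW.
have [c [cpath clast]] := optimal_path_exists p rhoM T0.
have [f hf] := choice (nearest_exists m).
exists ((p, 0) :: [seq (z.1, f z.2) | z <- c]), c, [seq (z.1, f z.2) | z <- c]; split=> //.
  by rewrite /unzip1 -map_comp.
by elim: c {cpath clast} => //= z c ->; rewrite andbT mem_set.
Qed.

End Value.

(** * Lebesgue measure and L2 norms *)

Section Translation.
Variable R : realType.
Local Notation mu := (@lebesgue_measure R).

Lemma measurable_shift (a : R) : measurable_fun [set: R] (fun x : R => x - a).
Proof. exact: (measurable_funB (@measurable_id _ _ _) (measurable_cst a)). Qed.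

Lemma lebesgue_measure_shift (a : R) (A : set (measurableTypeR R)) : measurable A ->
  mu ((fun x => x - a) @^-1` A) = mu A.
Proof.
move=> mA; apply/esym.
have mf := measurable_shift a.
apply: (@lebesgue_measure_unique R
  [the measure _ _ of pushforward mu ((fun x : R => x - a) : _ -> measurableTypeR R)]) => //.
move=> _ [[x y] _ <-]; rewrite /= /pushforward.
have -> : (fun z : R => z - a) @^-1` `]x, y] = `]x + a, y + a]%classic.
  by apply/seteqP; split=> z /=; rewrite !in_itv /= ltrBrDr lerBlDr.
by rewrite !lebesgue_measure_itv /= !lte_fin ltrD2r -!EFinB opprD addrACA subrr addr0.
Qed.

Lemma negligible_shift (a : R) (A : set (measurableTypeR R)) :
  mu.-negligible A -> mu.-negligible [set x | A (x - a)].
Proof.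
case=> B [mB B0 AB]; exists ((fun x => x - a) @^-1` B); split=> [||x /AB//].
  by have := measurable_shift a measurableT mB; rewrite setTI.
by rewrite -[RHS]B0; apply: lebesgue_measure_shift.
Qed.

(** [leb0] is not translation invariant, whereas Lebesgue-negligible sets can be shifted, as
    juxtaposition requires. *)
Lemma ae_leb0P (T : R) (P : R -> Prop) :
  (\forall x \ae leb0 T, P x) <-> mu.-negligible [set x | 0 <= x <= T /\ ~ P x].
Proof.
split=> [[N [mN N0 PN]]|[N [mN N0 PN]]].
  exists (N `&` `[0, T]); split=> // [|x [xT nP]]; first exact: measurableI.
  by split; [exact: PN|rewrite /= in_itv].
exists (N `|` ~` `[0, T]); split.
- by apply: measurableU => //; apply: measurableC.
- rewrite /leb0 /= /mrestr setIUl setICl setU0; apply/eqP; rewrite -measure_le0 -N0.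
  apply: le_measure; rewrite ?inE //; exact: measurableI.
- move=> x /= nP; have [xT|xT] := pselect (0 <= x <= T); first by left; apply: PN.
  by right; rewrite /= in_itv.
Qed.

End Translation.

Lemma leb0_ae_filter (R : realType) (T : R) : Filter (almost_everywhere (leb0 T)).
Proof. exact: ae_filter_ringOfSetsType. Qed.

Section L2norm.
Variables (R : realType) (T : R).
Hypothesis T_gt0 : 0 < T.

Lemma leb0_setT : leb0 T [set: R] = T%:E.
Proof.
rewrite /leb0 /= /mrestr setTI lebesgue_measure_itv /= lte_fin T_gt0.
by rewrite -EFinB subr0.
Qed.

Lemma Lnorm2_le (f : R -> R) (d : R) : measurable_fun [set: measurableTypeR R] f ->
  0 <= d -> (\forall x \ae leb0 T, `|f x| <= d) ->
  ('N[leb0 T]_2%:E [EFin \o f] <= (d * Num.sqrt T)%:E)%E.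
Proof.
move=> mf d0 fd; rewrite unlock /Lnorm.
have h2 : (\int[leb0 T]_x (`|(EFin \o f) x| `^ 2) <= (d ^+ 2 * T)%:E)%E.
  apply: (@le_trans _ _ (\int[leb0 T]_x (cst (d ^+ 2)%:E x))%E); last first.
    by rewrite integral_cst // leb0_setT.
  apply: ae_ge0_le_integral => //.
  - by move=> x _; apply: poweR_ge0.
  - apply: (@measurableT_comp _ _ _ _ _ _ (fun x => x `^ 2)%E) => //=.
      exact: measurable_poweR.
    by apply/measurable_EFinP; apply: measurableT_comp.
  - by move=> x _; rewrite lee_fin sqr_ge0.
  move: fd; have ? := leb0_ae_filter T; apply: filterS => x fx _ /=.
  by rewrite lee_fin powR_mulrn // lerXn2r // nnegrE.
apply: le_trans (gt0_ler_poweR _ _ _ h2) _ => //.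
- by rewrite in_itv /= leey andbT; apply: integral_ge0 => x _; rewrite ?lee_fin; apply: powR_ge0.
- by rewrite in_itv /= leey andbT lee_fin mulr_ge0 ?sqr_ge0 // ltW.
rewrite poweR12_sqrt; last by rewrite lee_fin mulr_ge0 ?sqr_ge0 // ltW.
by rewrite /= lee_fin sqrtrM ?sqr_ge0 // sqrtr_sqr ger0_norm.
Qed.

Lemma L2_of_bounded (f : R -> R) (d : R) : measurable_fun [set: measurableTypeR R] f ->
  (forall x, `|f x| <= d) -> exists g : L2 T, \forall x \ae leb0 T, g x = f x.
Proof.
move=> mf fd; have d0 : 0 <= d by apply: le_trans (fd 0).
pose fm : {mfun measurableTypeR R >-> measurableTypeR R} :=
  @mfun_Sub _ _ (measurableTypeR R) (measurableTypeR R) f (mem_set mf).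
pose g : aeEqMfun (measurableTypeR R) (leb0 T) :=
  (\pi_(aeEqMfun (measurableTypeR R) (leb0 T)) fm)%qT.
have gf : \forall x \ae leb0 T, g x = f x.
  have : (repr g == fm %[mod aeEqMfun (measurableTypeR R) (leb0 T)])%qT by rewrite reprK.
  rewrite eqmodE => /asboolP; have ? := leb0_ae_filter T.
  by apply: filterS => x /(_ I).
have gfin : finite_norm (leb0 T) 2%:E g.
  rewrite /finite_norm; apply: (@le_lt_trans _ _ (d * Num.sqrt T)%:E); last exact: ltry.
  apply: Lnorm2_le => //; first exact: (@measurable_funPT _ _ _ _ (repr g)).
  have ? := leb0_ae_filter T.
  by move: gf; apply: filterS => x ->.
by exists (LebesgueSpace.Pack (LebesgueSpace.Class (isFinLebesgue.Build _ _ _ _ _ _ _ gfin))).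
Qed.

End L2norm.

(** Turns weights on profiles into weights on paths. The sum over [X], possibly infinite, reduces to
    the range of [h], outside which the pushed weights vanish. *)
Lemma fsum_pushforward (R : realType) (I : finType) (K : choiceType) (h : I -> K)
    (X : set K) (w : I -> R) (g : K -> R) : (forall s, w s != 0 -> X (h s)) ->
  \sum_(x \in X) (\sum_(s | h s == x) w s) * g x = \sum_s w s * g (h s).
Proof.
move=> wX; pose D := [set` undup (codom h)].
have hD s : D (h s) by rewrite /D /= mem_undup codom_f.
transitivity (\sum_(x \in D) (\sum_(s | h s == x) w s) * g x).
  rewrite -(@fsbig_widen _ _ _ _ (X `&` D) X); last 2 first.
  - by move=> x [].
  - move=> x [Xx nXD]; rewrite /preimage /= big_pred0 ?mul0r // => s.
    by apply/eqP => hs; apply: nXD; split=> //; rewrite -hs.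
  apply: fsbig_widen => x; first by case.
  move=> [Dx nXD]; rewrite /preimage /= big1 ?mul0r // => s /eqP hs.
  by apply/eqP; apply: contra_notT nXD => /wX; rewrite hs.
rewrite /D -fsbig_seq ?undup_uniq //.
under eq_bigr do rewrite mulr_suml.
rewrite (exchange_big_dep predT) //=; apply: eq_bigr => s _.
rewrite big_mkcond (bigD1_seq (h s)) ?undup_uniq ?mem_undup ?codom_f //= eqxx.
by rewrite big1 ?addr0 // => x; rewrite eq_sym => /negbTE->.
Qed.

Section Juxtapose.
Variables (R : realType) (N : nat) (T : R).
Hypothesis T_gt0 : 0 < T.
Implicit Type rho : node N -> L2 T.

(** The exceptional set lies in the countable union of the translates by [j%:R * T] of the
    exceptional sets of the components. Beyond the last node both sides use the default
    [top_node]. *)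
Lemma juxtapose_ae rho (P : node N -> R -> R -> Prop) (S : R) :
  (forall p, \forall x \ae leb0 T, P p x (rho p x)) ->
  \forall x \ae leb0 S, let j := Num.truncn (x / T) in
    P (nth (top_node N) (enum (node N)) j) (x - j%:R * T) (juxtapose rho x).
Proof.
move=> Prho; apply/ae_leb0P.
pose p_ j := nth (top_node N) (enum (node N)) j.
pose B j := [set y : R | 0 <= y <= T /\ ~ P (p_ j) y (rho (p_ j) y)].
have : (@lebesgue_measure R).-negligible (\bigcup_j [set x | B j (x - j%:R * T)]).
  by apply: negligible_bigcup => j; apply: negligible_shift; exact/ae_leb0P/Prho.
apply: negligibleS => x [/andP[x0 _] nP]; exists (Num.truncn (x / T)) => //.
split=> //; have := truncn_itv (divr_ge0 x0 (ltW T_gt0)).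
rewrite ler_pdivlMr // ltr_pdivrMr // -natr1 mulrDl mul1r; lra.
Qed.

Lemma L2dist_le rho rho' (d : R) : 0 <= d ->
  (forall p, \forall x \ae leb0 T, `|(rho p x : R) - rho' p x| <= d) ->
  L2dist rho rho' <= d * Num.sqrt (#|node N|%:R * T).
Proof.
move=> d0 rd; have dE : d = Num.sqrt (d ^+ 2) by rewrite sqrtr_sqr ger0_norm.
rewrite [X in X * _]dE -sqrtrM ?sqr_ge0 // /L2dist ler_wsqrtr //.
have -> : d ^+ 2 * (#|node N|%:R * T) = \sum_(p : node N) d ^+ 2 * T.
  by rewrite sumr_const -mulr_natl; ring.
apply: ler_sum => p _.
have Tsq : d ^+ 2 * T = (d * Num.sqrt T) ^+ 2 by rewrite exprMn sqr_sqrtr // ltW.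
rewrite Tsq lerXn2r // ?nnegrE ?mulr_ge0 ?sqrtr_ge0 //; first exact/fine_ge0/Lnorm_ge0.
have mf : measurable_fun [set: measurableTypeR R] (fun x => (rho p x : R) - (rho' p x : R)).
  exact: (measurable_funB (@measurable_funPT _ _ _ _ (repr (rho p : aeEqMfun _ _)))
    (@measurable_funPT _ _ _ _ (repr (rho' p : aeEqMfun _ _)))).
have L2le := Lnorm2_le T_gt0 mf d0 (rd p).
rewrite -lee_fin fineK; first exact: L2le.
by rewrite ge0_fin_numE; [exact: le_lt_trans L2le (ltry _)|exact: Lnorm_ge0].
Qed.

End Juxtapose.

Section Evolution.
Variables (R : realType) (N : nat) (T : R).
Implicit Types (pi : seq (node N * R)) (k : node N).

Let alive pi k : set R := [set t : R | exists2 i, (i < size pi)%N &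
        nth k (unzip1 pi) i = k /\
        nth T (unzip2 pi) i <= t < nth T (unzip2 pi) i.+1].

Lemma measurable_evolution pi k :
  measurable_fun [set: measurableTypeR R] (evolution T pi k).
Proof.
have mE : measurable (alive pi k : set (measurableTypeR R)).
  rewrite (_ : alive pi k = \bigcup_(i in [set i | (i < size pi)%N /\ nth k (unzip1 pi) i = k])
      `[nth T (unzip2 pi) i, nth T (unzip2 pi) i.+1[%classic); last first.
    apply/seteqP; split=> t /= [i].
      by move=> ipi [ik it]; exists i => //=; rewrite in_itv.
    by case=> ipi ik; rewrite /= in_itv => it; exists i.
  by apply: bigcup_measurable => i _; apply: measurable_itv.
exact: measurable_indic.
Qed.

Lemma evolution_ge0 pi k t : 0 <= evolution T pi k t.
Proof. by rewrite /evolution indicE ler0n. Qed.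

Lemma evolution_le1 pi k t : evolution T pi k t <= 1.
Proof. by rewrite /evolution indicE lern1 leq_b1. Qed.

(** All switching times are grid points, and so is the default end time [T], so their comparison
    with [t] has the same outcome throughout an open cell. *)
Lemma evolution_cell (m i : nat) pi k (t t' : R) : (0 < m)%N -> 0 < T ->
  (forall x, x \in unzip2 pi -> grid T m x) ->
  i%:R * (T / m%:R) < t < i.+1%:R * (T / m%:R) ->
  i%:R * (T / m%:R) < t' < i.+1%:R * (T / m%:R) ->
  evolution T pi k t = evolution T pi k t'.
Proof.
move=> m0 T0 gpi tcell t'cell; have eps0 : 0 < T / m%:R by rewrite divr_gt0 ?ltr0n.
have gT n : grid T m (nth T (unzip2 pi) n).
  have [nlt|nge] := ltnP n (size (unzip2 pi)); first exact/gpi/mem_nth.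
  rewrite nth_default //; exists m => //=.
  by rewrite mulrC divfK // pnatr_eq0 -lt0n.
have cmp x u : grid T m x -> i%:R * (T / m%:R) < u < i.+1%:R * (T / m%:R) ->
    (x <= u) = (x <= i%:R * (T / m%:R)).
  case=> l /= _ <- /andP[iu ui]; apply/idP/idP; last by move/le_lt_trans/(_ iu)/ltW.
  move=> /le_lt_trans/(_ ui); rewrite ltr_pM2r // ltr_nat ltnS.
  by rewrite ler_pM2r // ler_nat.
have lt_cmp x u : grid T m x -> i%:R * (T / m%:R) < u < i.+1%:R * (T / m%:R) ->
    (u < x) = (i%:R * (T / m%:R) < x) by move=> gx iu; rewrite !ltNge (cmp x u).
rewrite /evolution !indicE; congr (_%:R); congr nat_of_bool.
apply/idP/idP; rewrite !inE => -[n npi [nk]] ntt; exists n => //; split=> //; move: ntt.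
  by rewrite (cmp _ _ (gT n) tcell) (cmp _ _ (gT n) t'cell)
    (lt_cmp _ _ (gT n.+1) tcell) (lt_cmp _ _ (gT n.+1) t'cell).
by rewrite (cmp _ _ (gT n) tcell) (cmp _ _ (gT n) t'cell)
    (lt_cmp _ _ (gT n.+1) tcell) (lt_cmp _ _ (gT n.+1) t'cell).
Qed.

End Evolution.

(** * Masses generated by mixed profiles *)

Section Mixture.
Variables (R : realType) (N : nat) (T : R) (m : nat) (I : finType).
Variables (rho0 : node N -> R) (pth : node N -> I -> seq (node N * R)).
Hypothesis T_gt0 : 0 < T.
Hypothesis m_gt0 : (0 < m)%N.
Hypothesis rho0_ge0 : forall p, 0 <= rho0 p.
Hypothesis rho0_le1 : \sum_p rho0 p <= 1.
Hypothesis pth_grid : forall j s x, x \in unzip2 (pth j s) -> grid T m x.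
Implicit Types (w : I -> R) (k : node N) (t : R) (rho : node N -> L2 T).

Definition mixture w k t : R :=
  \sum_j rho0 j * \sum_s w s * evolution T (pth j s) k t.

Lemma measurable_mixture w k : measurable_fun [set: measurableTypeR R] (mixture w k).
Proof.
apply: measurable_sum => j; apply: measurable_funM => //.
apply: measurable_sum => s; apply: measurable_funM => //.
exact: measurable_evolution.
Qed.

(** The initial masses sum to at most 1 and evolutions lie in [0, 1]. The bound is uniform in [t],
    which makes the masses continuous in [w] for the L2 distance. *)
Lemma mixtureB w w' k t : `|mixture w k t - mixture w' k t| <= \sum_s `|w s - w' s|.
Proof.
rewrite /mixture -sumrB; under eq_bigr do rewrite -mulrBr -sumrB.
apply: (@le_trans _ _ (\sum_j rho0 j * \sum_s `|w s - w' s|)); last first.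
  by rewrite -mulr_suml ler_piMl // sumr_ge0.
apply: le_trans (ler_norm_sum _ _ _) _; apply: ler_sum => j _.
rewrite normrM ger0_norm // ler_wpM2l //.
apply: le_trans (ler_norm_sum _ _ _) _; apply: ler_sum => s _.
rewrite -mulrBl normrM ler_piMr // ger0_norm ?evolution_ge0 //.
exact: evolution_le1.
Qed.

Lemma mixture_range w k t : simplex w -> 0 <= mixture w k t <= \sum_p rho0 p.
Proof.
move=> [w0 w1]; apply/andP; split.
  apply: sumr_ge0 => j _; rewrite mulr_ge0 // sumr_ge0 // => s _.
  by rewrite mulr_ge0 // evolution_ge0.
apply: ler_sum => j _; rewrite ler_piMr // -w1; apply: ler_sum => s _.
by rewrite ler_piMr // evolution_le1.
Qed.

Lemma mixture_cell w k i t t' :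
  i%:R * (T / m%:R) < t < i.+1%:R * (T / m%:R) ->
  i%:R * (T / m%:R) < t' < i.+1%:R * (T / m%:R) -> mixture w k t = mixture w k t'.
Proof.
move=> it it'; apply: eq_bigr => j _; congr (_ * _); apply: eq_bigr => s _.
by congr (_ * _); apply: (evolution_cell (i := i) _ m_gt0 T_gt0 (@pth_grid j s)).
Qed.

Definition realizes rho w := forall k, \forall t \ae leb0 T, rho k t = mixture w k t.

Lemma realizes_exists w : exists rho, realizes rho w.
Proof.
have ex k : exists g : L2 T, \forall t \ae leb0 T, g t = mixture w k t.
  apply: (L2_of_bounded (d := \sum_s `|w s|) T_gt0); first exact: measurable_mixture.
  (* Comparison with zero weights bounds the mixture for every [w], in the simplex or not. *)
  move=> t; have := mixtureB w (fun=> 0) k t.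
  have -> : mixture (fun=> 0) k t = 0.
    by rewrite /mixture big1 // => j _; rewrite big1 ?mulr0 // => s _; rewrite mul0r.
  by rewrite subr0; under eq_bigr do rewrite subr0.
by have [rho hrho] := choice ex; exists rho.
Qed.

Lemma realizes_masses rho w : simplex w -> realizes rho w -> masses rho.
Proof.
move=> sw rw p; have ? := leb0_ae_filter T; move: (rw p); apply: filterS => x ->.
by have /andP[-> /le_trans->] := mixture_range p x sw.
Qed.

Lemma realizes_C_eps rho w : simplex w -> realizes rho w -> C_eps m rho0 rho.
Proof.
move=> sw rw; split; first exact: realizes_masses rw.
(* Cell [k] of the long interval is cell [l] of component [j]; the constant is the mixture at the
   midpoint of that cell. *)
- move=> k kN; pose j := (k %/ m)%N; pose l := (k %% m)%N.
  pose q := nth (top_node N) (enum (node N)) j.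
  have eps0 : 0 < T / m%:R by rewrite divr_gt0 ?ltr0n.
  have Tm : T = m%:R * (T / m%:R) by rewrite mulrC divfK // pnatr_eq0 -lt0n.
  have kE : k%:R = j%:R * m%:R + l%:R :> R by rewrite -natrM -natrD -divn_eq.
  have lm : l.+1%:R * (T / m%:R) <= m%:R * (T / m%:R).
    by rewrite ler_pM2r // ler_nat ltn_mod.
  have l0 : 0 <= l%:R * (T / m%:R) by rewrite mulr_ge0 // ltW.
  exists (mixture w q ((l%:R + 2^-1) * (T / m%:R))).
  have ? := leb0_ae_filter ((2 ^ N)%N%:R * T).
  have := juxtapose_ae T_gt0 (P := fun p x y => y = mixture w p x) ((2 ^ N)%N%:R * T) rw.
  apply: filterS => x /= jux kx.
  have kx' : j%:R * T + l%:R * (T / m%:R) < x < j%:R * T + l.+1%:R * (T / m%:R).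
    have jT : j%:R * T = j%:R * m%:R * (T / m%:R) by rewrite {1}Tm mulrA.
    move: kx; rewrite -[k.+1%:R]natr1 -[l.+1%:R]natr1 kE jT => /andP[? ?].
    by apply/andP; split; lra.
  have xj : Num.truncn (x / T) = j.
    apply: truncn_def; rewrite ler_pdivlMr // ltr_pdivrMr // -natr1 mulrDl mul1r.
    move: kx' lm; rewrite -Tm => /andP[? ?] ?; apply/andP; split; lra.
  rewrite jux xj; apply: (@mixture_cell w q l).
    by move/andP: kx' => [? ?]; apply/andP; split; lra.
  by rewrite !ltr_pM2r // -[l.+1%:R]natr1; apply/andP; split; lra.
- rewrite unlock; case: ifPn => [_|_]; last by rewrite lee_fin sumr_ge0.
  apply/ess_supP; have ? := leb0_ae_filter ((2 ^ N)%N%:R * T).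
  have rw' p : \forall x \ae leb0 T, 0 <= (rho p x : R) <= \sum_p rho0 p.
    have ? := leb0_ae_filter T; move: (rw p); apply: filterS => x ->.
    exact: mixture_range.
  have := juxtapose_ae T_gt0 (P := fun p x y => 0 <= y <= \sum_p rho0 p) ((2 ^ N)%N%:R * T) rw'.
  by apply: filterS => x /= /andP[? ?]; rewrite lee_fin ger0_norm.
Qed.

Lemma realizes_L2dist rho rho' w w' : realizes rho w -> realizes rho' w' ->
  L2dist rho rho' <= (\sum_s `|w s - w' s|) * Num.sqrt (#|node N|%:R * T).
Proof.
move=> rw rw'; apply: L2dist_le => //; first exact: sumr_ge0.
move=> p; have ? := leb0_ae_filter T.
by move: (rw p) (rw' p); apply: filterS2 => x -> ->; apply: mixtureB.
Qed.

Lemma realizes_cvg (U : set_system nat) (FU : Filter U) (rho_ : nat -> node N -> L2 T)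
    rho (w_ : nat -> I -> R) w :
  (forall n, realizes (rho_ n) (w_ n)) -> realizes rho w ->
  (forall s, w_ n s @[n --> U] --> w s) -> L2dist (rho_ n) rho @[n --> U] --> 0.
Proof.
move=> rw_ rw wU.
have sumU : \sum_s `|w_ n s - w s| @[n --> U] --> \sum_(s : I) (0 : R).
  apply: cvg_big => [|s _]; first exact: add_continuous.
  have : w_ n s - w s @[n --> U] --> w s - w s by apply: cvgB (cvg_cst _).
  by rewrite subrr => /cvg_norm; rewrite normr0.
have s0 : \sum_(s : I) (0 : R) = 0 by rewrite big1.
rewrite s0 in sumU.
have bU : (\sum_s `|w_ n s - w s|) * Num.sqrt (#|node N|%:R * T) @[n --> U] --> 0.
  have := cvgM sumU (cvg_cst (Num.sqrt (#|node N|%:R * T))); rewrite mul0r => h; exact: h.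
apply: (squeeze_cvgr (f := fun=> 0) _ (cvg_cst 0) bU); apply: filterE => n.
by rewrite sqrtr_ge0; apply: realizes_L2dist.
Qed.

End Mixture.

(** * Profiles of grid paths and the fixed point *)

Section Profiles.
Variables (R : realType) (N : nat) (T : R) (m : nat).

(* One grid path per starting node: mixing over profiles, instead of mixing over
   the paths of each node separately, leaves a single simplex. *)
Definition profile : finType := {ffun node N -> N.-bseq (node N * 'I_m.+1)}.

Definition grid_time (z : node N * 'I_m.+1) : node N * R :=
  (z.1, z.2%:R * (T / m%:R)).

Definition profile_path (j : node N) (s : profile) : seq (node N * R) :=
  (j, 0) :: [seq grid_time z | z <- s j].

Lemma profile_path_grid j s x : x \in unzip2 (profile_path j s) -> grid T m x.
Proof.
rewrite /profile_path /= inE => /orP[/eqP->|]; first by exists 0%N => //=; rewrite mul0r.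
rewrite /unzip2 -map_comp => /mapP[z _ ->]; exists z.2 => //=.
by rewrite -ltnS.
Qed.

Variables (C : node N -> node N -> R -> R -> (node N -> L2 T) -> R).
Variables (Cf : node N -> R -> R).

Lemma size_opt_path rho p (t : R) c :
  path (fun a b => b \in opt_switch C Cf rho a.1 a.2) (p, t) c -> (size c <= zeros p)%N.
Proof.
elim: c p t => [|[q s] c ih] p t //= /andP[/set_mem[[_ _ pq _] _]] /ih.
by rewrite (next_zeros pq).
Qed.

(** Such a path has at most [N] switches, each at one of [m.+1] grid times, so the finite type of
    profiles accounts for all of them. *)
Lemma eps_paths_profile rho p pi : eps_paths C Cf m rho p pi ->
  exists c : N.-bseq (node N * 'I_m.+1), pi = (p, 0) :: [seq grid_time z | z <- c].
Proof.
move=> [c [ce [-> [/size_opt_path sz _] c1 call]]].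
have szce : (size ce <= N)%N.
  have := congr1 size c1; rewrite !size_map => ->.
  by rewrite (leq_trans sz) // leq_subr.
have [l lce] : exists l, ce = [seq grid_time z | z <- l].
  elim: ce c {sz szce} c1 call => [|[q x] ce ih] [|[q' s] c] //=; first by exists [::].
  move=> [_ c1] /andP[/set_mem[[k /= km <-] _] call].
  have [l ->] := ih c c1 call.
  by exists ((q, inord k) :: l); rewrite /= /grid_time /= inordK.
have szl : (size l <= N)%N by move: szce; rewrite lce size_map.
by exists (Bseq szl); rewrite lce.
Qed.

End Profiles.

Theorem theorem5p1 (R : realType) (N : nat) (T : R)
    (C : node N -> node N -> R -> R -> (node N -> L2 T) -> R)
    (Cf : node N -> R -> R) (rho0 : node N -> R) (m : nat) :
  (1 <= N)%N -> 0 < T ->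
  cost_nonneg C ->
  final_cost_regular T Cf ->
  cost_regular C ->
  cost_decreasing C -> cost_blowup C -> cost_continuous C ->
  cost_convention C ->
  order_preserving C Cf ->
  (forall p, 0 <= rho0 p) -> \sum_p rho0 p <= 1 ->
  (1 <= m)%N ->
  exists rho : node N -> L2 T, C_eps m rho0 rho /\ psi C Cf m rho0 rho rho.
Proof.
move=> _ T0 C_ge0 Cf_reg C_reg C_dec C_blow C_cont _ _ rho0_ge0 rho0_le1 m0.
pose I := profile N m; pose pth := @profile_path R N T m.
have pthg j s x : x \in unzip2 (pth j s) -> grid T m x := @profile_path_grid R N T m j s x.
have [G hG] := choice (@realizes_exists R N T I rho0 pth T0 rho0_ge0 rho0_le1).
have GM w : simplex w -> masses (G w).
  move=> sw; exact: (realizes_masses rho0_ge0 rho0_le1 sw (hG w)).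
have [U [UU U_oo]] := nat_ultrafilter.
pose A (s : I) (w : I -> R) := forall j, eps_paths C Cf m (G w) j (pth j s).
have A_cover w : simplex w -> exists s, A s w.
  move=> /GM wM.
  have cex j : exists c : N.-bseq (node N * 'I_m.+1),
      eps_paths C Cf m (G w) j ((j, 0) :: [seq grid_time T z | z <- c]).
    have [pi hpi] := eps_paths_nonempty T0 C_ge0 Cf_reg C_reg C_dec C_blow C_cont m j wM.
    by have [c pic] := eps_paths_profile hpi; exists c; rewrite -pic.
  have [c hc] := choice cex.
  by exists [ffun j => c j] => j; rewrite /pth /profile_path ffunE.
have A_closed s w (w_ : nat -> I -> R) : simplex w -> (forall n, simplex (w_ n)) ->
    (forall i, w_ n i @[n --> U] --> w i) -> (\forall n \near U, A s (w_ n)) -> A s w.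
  move=> sw sw_ wU As j.
  have GU : L2dist ((G \o w_) n) (G w) @[n --> U] --> 0.
    exact: (realizes_cvg T0 rho0_ge0 rho0_le1 _ (fun n => hG (w_ n)) (hG w) wU).
  apply: (eps_paths_closed T0 C_ge0 Cf_reg C_reg C_dec C_blow C_cont (fun n => GM _ (sw_ n))
    (GM _ sw) GU).
  by apply: filterS As => n /(_ j).
have I_gt0 : (0 < #|I|)%N by apply/card_gt0P; exists [ffun=> [bseq]].
have [w sw wA] := dual_KKM U_oo A_cover A_closed I_gt0.
have [w0 w1] := sw.
have wA' s : w s != 0 -> A s w by move=> ws; apply: wA; rewrite lt_neqAle eq_sym ws w0.
exists (G w); split; first exact: (realizes_C_eps T0 m0 rho0_ge0 rho0_le1 pthg sw (hG w)).
(* The weight of a path from [j] is the total weight of the profiles that follow it; by [wA'] these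
   weights are carried by the [eps]-optimal paths. *)
exists (fun j pi => \sum_(s | pth j s == pi) w s); split.
- by move=> j pi _; apply: sumr_ge0.
- move=> j; rewrite (eq_fsbigr (fun pi => (\sum_(s | pth j s == pi) w s) * 1)).
    rewrite (fsum_pushforward (fun=> 1)) => [|s /wA'//].
    by under eq_bigr do rewrite mulr1.
  by move=> pi _; rewrite mulr1.
move=> k; have ? := leb0_ae_filter T; move: (hG w k); apply: filterS => t ->.
apply: eq_bigr => j _; congr (_ * _).
by rewrite fsum_pushforward // => s /wA'.
Qed.
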